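(* Let $\mathbb{K}$ be a field and let $\mathbb{KS}=\bigoplus_{n\ge 0}\mathbb{K}S_n$ be the graded vector space with basis all permutations. Equipped with the coupling product $(a,b)\mapsto a\ltimes b^{\uparrow^n}$ ($a$ of degree $n$), the unit $\mu$, the draw coproduct $\bigtriangleup$ and the counit $\nu$, $\mathbb{KS}$ is a graded, connected, cocommutative, and free Hopf algebra (where free means that the underlying algebra is a free associative unital algebra).
   Context: Let $[n]=\{1,\dots,n\}$, let $S_n$ be the set of permutations of $[n]$, written as words $a=a_1a_2\cdots a_n$ with $a_i=a(i)$; $n$ is the degree of $a$. $S_0=\{\epsilon\}$ with $\epsilon$ the empty permutation. $\mathbb{K}S_n$ is the $\mathbb{K}$-vector space with basis $S_n$, and $\mathbb{KS}=\bigoplus_{n\ge0}\mathbb{K}S_n$ is graded with $n$-th component $\mathbb{K}S_n$. Atoms. Let $a=a_1\cdots a_n$ be a sequence of distinct positive integers. A position $i$ with $1\le i\le n-1$ is an absolute ascent of $a$ if $a_i<a_j$ for all $i<j\le n$. If $i_1<\cdots<i_{r-1}$ are all the absolute ascents of $a$, then the contiguous blocks $\alpha_1=a_1\cdots a_{i_1}$, $\alpha_2=a_{i_1+1}\cdots a_{i_2}$, ..., $\alpha_r=a_{i_{r-1}+1}\cdots a_n$ are the atoms of $a$, and one writes $a=\alpha_1|\alpha_2|\cdots|\alpha_r$ (the factorization of $a$). The empty sequence has no atoms ($r=0$). For $K=\{i_1<\cdots<i_\ell\}\subseteq[r]$ put $\alpha_K=\alpha_{i_1}|\alpha_{i_2}|\cdots|\alpha_{i_\ell}$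 (concatenation). Standardization. For a sequence $b$ of $\ell$ distinct positive integers, $\mathrm{st}(b)\in S_\ell$ is the permutation obtained by applying to each entry of $b$ the unique order-preserving bijection from the set of entries of $b$ to $[\ell]$; $\mathrm{st}(\epsilon)=\epsilon$. Draw coproduct. For a permutation $a=\alpha_1|\cdots|\alpha_r$, $\bigtriangleup(a)=\sum_{K\subseteq[r]}\mathrm{st}(\alpha_K)\otimes \mathrm{st}(\alpha_{[r]\setminus K})$, extended linearly. Counit: $\nu(\epsilon)=1$ and $\nu(a)=0$ for every permutation $a\neq\epsilon$. Coupling product. For a sequence $\beta=b_1\cdots b_\ell$ of positive integers, $\beta^{\uparrow^n}=(b_1+n)\cdots(b_\ell+n)$. For permutations $a=\alpha_1|\cdots|\alpha_r$ and $b=\beta_1|\cdots|\beta_s$ of degrees $n$ and $m$, $$a\ltimes b^{\uparrow^n}=\sum_{L\subseteq[r],\ f\colon L\hookrightarrow[s]}\ddot\alpha_1|\ddot\alpha_2|\cdots|\ddot\alpha_r|\beta_{t_1}^{\uparrow^n}|\beta_{t_2}^{\uparrow^n}|\cdots|\beta_{t_z}^{\uparrow^n},$$ the sum being over all subsets $L$ of $[r]$ and all injections $f\colon L\hookrightarrow[s]$, where $\{t_1<\cdots<t_z\}=[s]\setminus f(L)$, and $\ddot\alpha_i=\beta_{f(i)}^{\uparrow^n}\alpha_i$ (concatenation) if $i\in L$, $\ddot\alpha_i=\alpha_i$ if $i\notin L$. It is extended bilinearly to $\mathbb{KS}$. Unit: $\mu\colon\mathbb{K}\to\mathbb{KS}$,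 $\mu(1)=\epsilon$. A graded Hopf algebra is connected if its degree-$0$ component is isomorphic to $\mathbb{K}$. *)

(* Defs.v *)
From HB Require Import structures.
From mathcomp Require Import all_boot all_algebra.
From mathcomp Require Import finmap.
From mathcomp.multinomials Require Import monalg.
Set Implicit Arguments.
Unset Strict Implicit.
Unset Printing Implicit Defensive.
Import GRing.Theory.
Local Open Scope ring_scope.

(* A vector space with a chosen basis [B] is [{malg K[B]}], the finitely *)
(* supported functions B -> K; the basis vector of [b] is [<< b >>].  The *)
(* tensor product of the spaces with bases B and C is the space with basis *)
(* B * C, the vector [<< (b, c) >>] standing for b (x) c. *)

Section TensorProducts.
Variable K : fieldType.

Definition lin_ext (B : choiceType) (W : lmodType K) (f : B -> W)
    (u : {malg K[B]}) : W :=
  \sum_(b <- msupp u) u@_b *: f b.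

Definition tensor (B C : choiceType) (u : {malg K[B]}) (v : {malg K[C]}) :
    {malg K[(B * C)%type]} :=
  lin_ext (fun b => lin_ext (fun c => << (b, c) >>) v) u.

Definition tensor_map (B C B' C' : choiceType)
    (f : {malg K[B]} -> {malg K[B']}) (g : {malg K[C]} -> {malg K[C']})
    (t : {malg K[(B * C)%type]}) : {malg K[(B' * C')%type]} :=
  lin_ext (fun p => tensor (f << p.1 >>) (g << p.2 >>)) t.

Definition tensor_assoc (B C D : choiceType)
    (t : {malg K[(B * C * D)%type]}) : {malg K[(B * (C * D))%type]} :=
  lin_ext (fun p => << (p.1.1, (p.1.2, p.2)) >>) t.

Definition tensor_swap (B C : choiceType) (t : {malg K[(B * C)%type]}) :
    {malg K[(C * B)%type]} :=
  lin_ext (fun p => << (p.2, p.1) >>) t.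

(* (x (x) y) (x' (x) y') = x x' (x) y y', extended bilinearly. *)
Definition tensor_mul (B : choiceType)
    (mul : {malg K[B]} -> {malg K[B]} -> {malg K[B]})
    (t t' : {malg K[(B * B)%type]}) : {malg K[(B * B)%type]} :=
  lin_ext (fun p => lin_ext (fun q =>
    tensor (mul << p.1 >> << q.1 >>) (mul << p.2 >> << q.2 >>)) t') t.

End TensorProducts.

Section HopfAlgebras.
Variables (K : fieldType) (B : choiceType).
Local Notation V := {malg K[B]}.
Local Notation VV := {malg K[(B * B)%type]}.

Variables (mul : V -> V -> V) (eta : K -> V) (Delta : V -> VV) (nu : V -> K).

Record is_algebra : Prop := IsAlgebra {
  alg_mul_linearl : forall y, linear (fun x => mul x y);
  alg_mul_linearr : forall x, linear (mul x);
  alg_unit_linear : linear (eta : K^o -> V);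
  alg_mulA : associative mul;
  alg_mul1l : left_id (eta 1) mul;
  alg_mul1r : right_id (eta 1) mul
}.

(* In the counit laws K (x) V and V (x) K are identified with V. *)
Record is_coalgebra : Prop := IsCoalgebra {
  coalg_comul_linear : linear Delta;
  coalg_counit_linear : scalar nu;
  coalg_coassoc : forall x,
    tensor_assoc (tensor_map Delta id (Delta x)) = tensor_map id Delta (Delta x);
  coalg_counitl : forall x,
    lin_ext (fun p => nu << p.1 >> *: (<< p.2 >> : V)) (Delta x) = x;
  coalg_counitr : forall x,
    lin_ext (fun p => nu << p.2 >> *: (<< p.1 >> : V)) (Delta x) = x
}.

Record is_bialgebra : Prop := IsBialgebra {
  bialg_algebra : is_algebra;
  bialg_coalgebra : is_coalgebra;
  bialg_comulM : forall x y, Delta (mul x y) = tensor_mul mul (Delta x) (Delta y);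
  bialg_comul1 : Delta (eta 1) = tensor (eta 1) (eta 1);
  bialg_counitM : forall x y, nu (mul x y) = nu x * nu y;
  bialg_counit1 : nu (eta 1) = 1
}.

Record is_antipode (S : V -> V) : Prop := IsAntipode {
  antipode_linear : linear S;
  antipode_left : forall x,
    lin_ext (fun p => mul (S << p.1 >>) << p.2 >>) (Delta x) = eta (nu x);
  antipode_right : forall x,
    lin_ext (fun p => mul << p.1 >> (S << p.2 >>)) (Delta x) = eta (nu x)
}.

End HopfAlgebras.

(* A degree function [d] on the basis splits {malg K[B]} into the direct sum *)
(* of the subspaces spanned by the basis elements of degree n, whose elements *)
(* are recognised by [homogeneous d n]. *)
Definition homogeneous (K : fieldType) (B : choiceType) (d : B -> nat) (n : nat)
    (v : {malg K[B]}) : Prop :=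
  forall b, b \in msupp v -> d b = n.

Section GradedHopfAlgebras.
Variables (K : fieldType) (B : choiceType) (d : B -> nat).
Local Notation V := {malg K[B]}.
Local Notation VV := {malg K[(B * B)%type]}.

Definition tensor_deg (p : B * B) : nat := (d p.1 + d p.2)%N.

(* All the structure maps, the antipode included, preserve degrees; K is *)
(* concentrated in degree 0. *)
Record is_graded_hopf_algebra (mul : V -> V -> V) (eta : K -> V)
    (Delta : V -> VV) (nu : V -> K) : Prop := IsGradedHopfAlgebra {
  ghopf_bialgebra : is_bialgebra mul eta Delta nu;
  ghopf_antipode : exists S : V -> V,
    is_antipode mul eta Delta nu S /\
    (forall n x, homogeneous d n x -> homogeneous d n (S x));
  ghopf_mul_graded : forall m n x y,
    homogeneous d m x -> homogeneous d n y -> homogeneous d (m + n)%N (mul x y);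
  ghopf_unit_graded : forall c, homogeneous d 0%N (eta c);
  ghopf_comul_graded : forall n x,
    homogeneous d n x -> homogeneous tensor_deg n (Delta x);
  ghopf_counit_graded : forall n x,
    homogeneous d n x -> n <> 0%N -> nu x = 0
}.

Definition is_connected : Prop :=
  exists phi : K -> V,
    [/\ linear (phi : K^o -> V), injective phi
      & forall v, homogeneous d 0%N v <-> exists c, v = phi c].

Definition is_cocommutative (Delta : V -> VV) : Prop :=
  forall x, tensor_swap (Delta x) = Delta x.

(* [{malg K[{fmonom X}]}] is the monoid algebra of the free monoid on X, that *)
(* is the algebra K<X> of noncommutative polynomials. *)
Definition is_free_algebra (mul : V -> V -> V) (eta : K -> V) : Prop :=
  exists (X : choiceType) (phi : {malg K[{fmonom X}]} -> V),
    [/\ linear phi, bijective phi, phi 1 = eta 1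
      & forall x y, phi (x * y) = mul (phi x) (phi y)].

End GradedHopfAlgebras.

Local Open Scope nat_scope.

(* S_n is the set of the [a : permutation] with [size a = n]. *)
Record permutation := Permutation {
  word :> seq nat;
  _ : perm_eq word (iota 1 (size word))
}.
HB.instance Definition _ := [isSub for word].
HB.instance Definition _ := [Choice of permutation by <:].

Definition empty_permutation : permutation := @Permutation [::] isT.

Definition degree (a : permutation) : nat := size a.

(* Positions are numbered from 1, as are the entries: a_i is nth 0 a i.-1. *)
Definition absolute_ascent (a : seq nat) (i : nat) : bool :=
  (1 <= i < size a) && all (fun y => nth 0 a i.-1 < y) (drop i a).

Definition atom_ends (a : seq nat) : seq nat :=
  [seq i <- iota 1 (size a) | absolute_ascent a i || (i == size a)].

Definition atoms (a : seq nat) : seq (seq nat) :=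
  reshape (pairmap (fun i j => j - i) 0 (atom_ends a)) a.

Notation num_atoms a := (size (atoms a)).

Definition atom (a : seq nat) (i : 'I_(num_atoms a)) : seq nat :=
  nth [::] (atoms a) i.
Arguments atom : clear implicits.

Definition select_atoms (a : seq nat) (J : {set 'I_(num_atoms a)}) : seq nat :=
  \big[cat/[::]]_(i in J) atom a i.

(* The order-preserving bijection from the entries of b to {1, ..., size b} *)
(* maps x to the number of entries that are at most x. *)
Definition standardize (b : seq nat) : seq nat :=
  [seq count (fun y => y <= x) b | x <- b].

Definition shift (n : nat) (b : seq nat) : seq nat := [seq x + n | x <- b].

(* A pair (L, f) with L a subset of [r] and f : L -> [s] injective is encoded *)
(* as a function to [option 'I_s] that is injective where it is not [None]; L *)
(* is the set of the i with [f i <> None]. *)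
Definition partial_injective (r s : nat) (f : {ffun 'I_r -> option 'I_s}) :=
  [forall i, forall j, (f i != None) && (f i == f j) ==> (i == j)].

Definition partial_injection (r s : nat) :=
  {f : {ffun 'I_r -> option 'I_s} | partial_injective f}.

Definition coupled_atom (a b : seq nat) (n : nat)
    (f : partial_injection (num_atoms a) (num_atoms b))
    (i : 'I_(num_atoms a)) : seq nat :=
  if val f i is Some t then shift n (atom b t) ++ atom a i else atom a i.

Definition couple_word (a b : seq nat) (n : nat)
    (f : partial_injection (num_atoms a) (num_atoms b)) : seq nat :=
  \big[cat/[::]]_(i < num_atoms a) coupled_atom n f i ++
  \big[cat/[::]]_(t < num_atoms b | Some t \notin codom (val f))
     shift n (atom b t).

Lemma flatten_atoms a : flatten (atoms a) = a.
Proof.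
rewrite /atoms reshapeKr //.
have E: last 0 (atom_ends a) = size a.
  rewrite /atom_ends; case: (size a) => // n.
  by rewrite -addn1 iotaD filter_cat /= add1n addn1 eqxx orbT last_cat.
have H s x : last x s <= x + sumn (pairmap (fun i j => j - i) x s).
  elim: s x => [|y s IH] x /=; first by rewrite addn0.
  apply: leq_trans (IH y) _; rewrite addnA leq_add2r.
  by rewrite -maxnE leq_maxr.
by have:= H (atom_ends a) 0; rewrite E add0n.
Qed.

Lemma count_bigcat (I : Type) (r : seq I) (P : pred I) (F : I -> seq nat) p :
  count p (\big[cat/[::]]_(i <- r | P i) F i) = \sum_(i <- r | P i) count p (F i).
Proof. by apply: (big_morph (count p)) => // x y; rewrite count_cat. Qed.

Lemma sum_count_atom a p : \sum_(i < num_atoms a) count p (atom a i) = count p a.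
Proof.
rewrite -[in RHS](flatten_atoms a) count_flatten sumnE big_map.
by rewrite (big_nth [::]) big_mkord.
Qed.

Lemma uniq_permutation (a : permutation) : uniq a.
Proof. by case: a => a /= aP; rewrite (perm_uniq aP) iota_uniq. Qed.

Lemma standardize_subproof (b : seq nat) : uniq b ->
  perm_eq (standardize b) (iota 1 (size (standardize b))).
Proof.
move=> Ub; have lt_count x y : y \in b -> x < y ->
    count (fun z => z <= x) b < count (fun z => z <= y) b.
  move=> yb lt_xy; rewrite -2!size_filter.
  apply: (@uniq_leq_size _ (y :: _)) => [|z].
    by rewrite /= mem_filter leqNgt lt_xy filter_uniq.
  rewrite inE !mem_filter => /orP[/eqP-> | /andP[le_zx ->]]; first by rewrite leqnn.
  by rewrite (leq_trans le_zx (ltnW lt_xy)).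
have Us : uniq (standardize b).
  rewrite map_inj_in_uniq // => x y xb yb eq_xy.
  by case: (ltngtP x y) => // lt_xy;
    [have := lt_count _ _ yb lt_xy | have := lt_count _ _ xb lt_xy];
    rewrite eq_xy ltnn.
apply: uniq_perm => //; first exact: iota_uniq.
suff sub : {subset standardize b <= iota 1 (size (standardize b))}.
  by have [] := uniq_min_size Us sub; rewrite ?size_iota.
move=> _ /mapP[x xb ->]; rewrite mem_iota add1n ltnS size_map count_size andbT.
by rewrite -has_count; apply/hasP; exists x.
Qed.

Lemma uniq_select_atoms (a : permutation) (J : {set 'I_(num_atoms a)}) :
  uniq (select_atoms J).
Proof.
apply: count_mem_uniq => x.
have: count_mem x (select_atoms J) <= 1.
  rewrite count_bigcat.
  apply: (@leq_trans (count_mem x a)).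
    by rewrite -sum_count_atom [leqRHS](bigID (mem J)) leq_addr.
  by rewrite count_uniq_mem ?uniq_permutation // leq_b1.
by rewrite -has_pred1 has_count; case: count => [|[|]].
Qed.

(* st(alpha_J), with alpha_J the concatenation of the atoms indexed by J. *)
Definition draw_part (a : permutation) (J : {set 'I_(num_atoms a)}) :
    permutation :=
  Permutation (standardize_subproof (uniq_select_atoms J)).

Lemma couple_subproof (a b : permutation)
    (f : partial_injection (num_atoms a) (num_atoms b)) :
  perm_eq (couple_word (degree a) f) (iota 1 (size (couple_word (degree a) f))).
Proof.
suff couple_perm : perm_eq (couple_word (degree a) f)
                           (iota 1 (degree a + degree b)).
  by rewrite (perm_size couple_perm) size_iota.
have shift_perm : perm_eq (a ++ shift (degree a) b)
                          (iota 1 (degree a + degree b)).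
  rewrite iotaD; apply: perm_cat; first by case: (a).
  rewrite addnC iotaDl /shift (eq_map (fun x => addnC x (degree a))).
  by apply: perm_map; case: (b).
apply: perm_trans shift_perm; apply/permP => p.
rewrite /couple_word !count_cat !count_bigcat.
set q := preim (addn^~ (degree a)) p.
have -> : count p (shift (degree a) b) = count q b by rewrite count_map.
rewrite -(sum_count_atom b q).
rewrite [in RHS](bigID (fun t => Some t \in codom (val f))) /=.
under [X in _ + X = _]eq_bigr do rewrite count_map.
rewrite addnA; congr (_ + _).
rewrite -(sum_count_atom a p).
have -> : \sum_(t < num_atoms b | Some t \in codom (val f)) count q (atom b t) =
    \sum_(i < num_atoms a) oapp (fun t => count q (atom b t)) 0 (val f i).
  transitivity (\sum_(t < num_atoms b)
      \sum_(i < num_atoms a | val f i == Some t) count q (atom b t)).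
    rewrite big_mkcond; apply: eq_bigr => t _; case: ifPn => [/codomP[i fi]|ft].
      rewrite (big_pred1 i) // => j /=; apply/eqP/eqP => [fj | ->//].
      apply/esym/eqP; have /forallP/(_ i)/forallP/(_ j) := valP f.
      by rewrite -fi fj eqxx.
    by rewrite big_pred0 // => i; apply: contraNF ft => /eqP <-; apply: codom_f.
  rewrite (exchange_big_dep predT) //=; apply: eq_bigr => i _.
  case: (val f i) => [t|] /=; last by rewrite big_pred0.
  by rewrite (big_pred1 t) // => u; rewrite -[RHS]eq_sym.
rewrite -big_split; apply: eq_bigr => i _; rewrite /coupled_atom /=.
by case: (sval f i) => [t|] /=; rewrite ?addn0 // count_cat count_map addnC.
Qed.

Definition couple (a b : permutation)
    (f : partial_injection (num_atoms a) (num_atoms b)) : permutation :=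
  Permutation (couple_subproof f).

Section PermutationHopfAlgebra.
Local Open Scope ring_scope.
Variable K : fieldType.

Local Notation KS := {malg K[permutation]}.
Local Notation KSKS := {malg K[(permutation * permutation)%type]}.

Definition coupling_product (u v : KS) : KS :=
  lin_ext (fun a : permutation => lin_ext (fun b : permutation =>
    \sum_(f : partial_injection (num_atoms a) (num_atoms b)) << couple f >>) v) u.

Definition KS_unit (c : K) : KS := << c *g empty_permutation >>.

Definition draw_coproduct (u : KS) : KSKS :=
  lin_ext (fun a : permutation =>
    \sum_(J : {set 'I_(num_atoms a)}) << (draw_part J, draw_part (~: J)) >>) u.

Definition KS_counit (u : KS) : K :=
  lin_ext (fun a => (a == empty_permutation)%:R : K^o) u.

End PermutationHopfAlgebra.

(* Main.v *)
Require Import Defs.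
From mathcomp Require Import all_boot all_algebra.
From HB Require Import structures.
From mathcomp Require Import ssrAC finmap.
From mathcomp.multinomials Require Import monalg.
Set Implicit Arguments.
Unset Strict Implicit.
Unset Printing Implicit Defensive.
Import GRing.Theory.

(** A word is determined by the set of its atoms: each atom ends with its least
letter, and the atoms are listed by increasing last letter.  So the draw
coproduct splits a list of atoms into two sublists, and the coupling product
sums over all partial matchings between two lists of atoms, matched atoms being
concatenated.  These operations commute with order-preserving relabellings of
the letters, hence with standardization, and the bialgebra axioms become
identities between sums over lists: in a product of three factors every
resulting atom is [z ++ y ++ x], with at most one atom from each factor,
whatever the bracketing.  The antipode is Takeuchi's alternating sum of
convolution powers.  For freeness, the term of [a * b] with the most atoms is
the direct sum [a ++ shift (degree a) b], and permutations form under direct sum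
the free monoid on the indecomposable ones; so the algebra map from the free
algebra on the indecomposables is unitriangular for the number of atoms. *)

(** * Matchings and splittings of lists of blocks *)

Section Couplings.
Variable T : Type.

(** Positions are enumerated rather than values, so the identities below hold for lists with
    repeated entries, by plain induction. *)
Fixpoint picks (s : seq T) : seq (T * seq T) :=
  if s is x :: s' then (x, s') :: [seq (p.1, x :: p.2) | p <- picks s']
  else [::].

(** One pair for each set of positions: the selected entries and the entries of the complement, both
    in their original order. This is the index set of the draw coproduct. *)
Fixpoint splits (s : seq T) : seq (seq T * seq T) :=
  if s is x :: s' then
    [seq (x :: p.1, p.2) | p <- splits s'] ++
    [seq (p.1, x :: p.2) | p <- splits s']
  else [:: ([::], [::])].

Section Sums.
Local Open Scope ring_scope.
Variable V : nmodType.

Lemma sum_picks_cons x s (F : T -> seq T -> V) :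
  \sum_(p <- picks (x :: s)) F p.1 p.2 =
  F x s + \sum_(p <- picks s) F p.1 (x :: p.2).
Proof. by rewrite big_cons big_map. Qed.

Lemma sum_splits_cons x s (F : seq T -> seq T -> V) :
  \sum_(p <- splits (x :: s)) F p.1 p.2 =
  \sum_(p <- splits s) F (x :: p.1) p.2 + \sum_(p <- splits s) F p.1 (x :: p.2).
Proof. by rewrite big_cat !big_map. Qed.

(** Picking twice enumerates the ordered pairs of distinct positions; exchanging the two members of
    a pair does not change the remainder. *)
Lemma sum_picks_swap s (F : T -> T -> seq T -> V) :
  \sum_(p <- picks s) \sum_(q <- picks p.2) F p.1 q.1 q.2 =
  \sum_(p <- picks s) \sum_(q <- picks p.2) F q.1 p.1 q.2.
Proof.
elim: s F => [|x s IH] F; first by rewrite !big_nil.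
rewrite (sum_picks_cons x s (fun y r => \sum_(q <- picks r) F y q.1 q.2)).
rewrite (sum_picks_cons x s (fun y r => \sum_(q <- picks r) F q.1 y q.2)).
under [X in _ + X = _]eq_bigr do
  rewrite (sum_picks_cons x _ (fun y r => F _ y r)).
under [X in _ = _ + X]eq_bigr do
  rewrite (sum_picks_cons x _ (fun y r => F y _ r)).
by rewrite !big_split /= (IH (fun y z r => F y z (x :: r))) addrCA.
Qed.

(** Complementation permutes the sets of positions; this gives cocommutativity. *)
Lemma sum_splits_swap s (F : seq T -> seq T -> V) :
  \sum_(p <- splits s) F p.2 p.1 = \sum_(p <- splits s) F p.1 p.2.
Proof.
elim: s F => [|x s IH] F; first by rewrite !big_seq1.
rewrite (sum_splits_cons x s (fun l r => F r l)) sum_splits_cons addrC.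
by rewrite (IH (fun l r => F (x :: l) r)) (IH (fun l r => F l (x :: r))).
Qed.

(** Both sides run over the distributions of the positions into three parts; this gives
    coassociativity. *)
Lemma sum_splits_assoc s (F : seq T -> seq T -> seq T -> V) :
  \sum_(p <- splits s) \sum_(q <- splits p.1) F q.1 q.2 p.2 =
  \sum_(p <- splits s) \sum_(q <- splits p.2) F p.1 q.1 q.2.
Proof.
elim: s F => [|x s IH] F; first by rewrite !big_seq1.
rewrite (sum_splits_cons x s (fun l r => \sum_(q <- splits l) F q.1 q.2 r)).
rewrite (sum_splits_cons x s (fun l r => \sum_(q <- splits r) F l q.1 q.2)).
under eq_bigr do rewrite (sum_splits_cons x _ (fun l r => F l r _)).
under [X in _ = _ + X]eq_bigr do
  rewrite (sum_splits_cons x _ (fun l r => F _ l r)).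
rewrite !big_split /= (IH (fun l m r => F (x :: l) m r)).
by rewrite (IH (fun l m r => F l (x :: m) r))
  (IH (fun l m r => F l m (x :: r))) addrA.
Qed.

(** Both sides mark one position and distribute the others into two parts; on the right the marked
    position is first counted in the left part. *)
Lemma sum_picks_splitsl s (F : T -> seq T -> seq T -> V) :
  \sum_(p <- picks s) \sum_(q <- splits p.2) F p.1 q.1 q.2 =
  \sum_(q <- splits s) \sum_(p <- picks q.1) F p.1 p.2 q.2.
Proof.
elim: s F => [|x s IH] F; first by rewrite big_seq1 !big_nil.
rewrite (sum_picks_cons x s (fun y r => \sum_(q <- splits r) F y q.1 q.2)).
rewrite (sum_splits_cons x s (fun l r => \sum_(p <- picks l) F p.1 p.2 r)).
under [X in _ + X = _]eq_bigr do
  rewrite (sum_splits_cons x _ (fun l r => F _ l r)).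
under [X in _ = X + _]eq_bigr do
  rewrite (sum_picks_cons x _ (fun y r => F y r _)).
rewrite !big_split /= (IH (fun y l r => F y (x :: l) r)).
by rewrite (IH (fun y l r => F y l (x :: r))) addrA.
Qed.

Lemma sum_picks_splitsr s (F : T -> seq T -> seq T -> V) :
  \sum_(p <- picks s) \sum_(q <- splits p.2) F p.1 q.1 q.2 =
  \sum_(q <- splits s) \sum_(p <- picks q.2) F p.1 q.1 p.2.
Proof.
under eq_bigr => p _ do rewrite -(sum_splits_swap p.2 (F p.1)).
rewrite (sum_picks_splitsl s (fun y l r => F y r l)).
exact: (sum_splits_swap s (fun l r => \sum_(p <- picks r) F p.1 l p.2)).
Qed.

End Sums.
End Couplings.

Section BlockCouplings.
Variable I : Type.
Local Notation block := (seq I).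

(** The pairs of a subset [L] and an injection [f], organised by recursion on the left factor: each
    block in turn chooses a partner among the blocks of [B] not yet taken, or none. *)
Fixpoint couplings (A B : seq block) : seq (seq block) :=
  if A is x :: A' then
    [seq x :: C | C <- couplings A' B] ++
    [seq (p.1 ++ x) :: C | p <- picks B, C <- couplings A' p.2]
  else [:: B].

Local Open Scope ring_scope.
Variable V : nmodType.

Lemma sum_couplings_cons x A B (F : seq block -> V) :
  \sum_(C <- couplings (x :: A) B) F C =
  \sum_(C <- couplings A B) F (x :: C) +
  \sum_(p <- picks B) \sum_(C <- couplings A p.2) F ((p.1 ++ x) :: C).
Proof. by rewrite big_cat big_map big_allpairs_dep. Qed.

(** A block of a coupling of [B] and [D] comes from [B] alone, from a matched pair, or from [D]
    alone, and the other blocks form a coupling of what remains. *)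
Lemma sum_picks_couplings B D (F : block -> seq block -> V) :
  \sum_(E <- couplings B D) \sum_(e <- picks E) F e.1 e.2 =
  \sum_(p <- picks B) \sum_(E <- couplings p.2 D) F p.1 E +
  \sum_(p <- picks B) \sum_(q <- picks D) \sum_(E <- couplings p.2 q.2)
     F (q.1 ++ p.1) E +
  \sum_(q <- picks D) \sum_(E <- couplings B q.2) F q.1 E.
Proof.
elim: B D F => [|x B IH] D F.
  rewrite /= !big_seq1 !big_nil !add0r.
  by apply: eq_bigr => q _; rewrite big_seq1.
rewrite sum_couplings_cons.
rewrite (sum_picks_cons x B (fun y r => \sum_(E <- couplings r D) F y E)).
rewrite (sum_picks_cons x B (fun y r =>
  \sum_(q <- picks D) \sum_(E <- couplings r q.2) F (q.1 ++ y) E)).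
under eq_bigr do rewrite sum_picks_cons.
under [X in _ + X = _]eq_bigr => q _.
  under eq_bigr do rewrite sum_picks_cons.
  rewrite big_split /= (IH q.2 (fun y r => F y ((q.1 ++ x) :: r))); over.
under [X in _ = _ + X + _ + _]eq_bigr do rewrite sum_couplings_cons.
under [X in _ = _ + (_ + X) + _]eq_bigr => p _.
  by under eq_bigr do rewrite sum_couplings_cons; rewrite big_split; over.
under [X in _ = _ + X]eq_bigr do rewrite sum_couplings_cons.
rewrite !big_split /= (IH D (fun y r => F y (x :: r))).
rewrite [X in _ + (_ + (X + _ + _)) = _]exchange_big /=.
(* Two blocks leave [D] here, one to be put in front of [x] and one to be picked; the order of the
   two removals is interchanged. *)
rewrite [X in _ + (_ + (_ + X)) = _](sum_picks_swap D (fun y z r =>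
  \sum_(E <- couplings B r) F z ((y ++ x) :: E))).
set d2 := (X in _ + (_ + (_ + X + _)) = _).
set d2' := (X in _ = _ + (_ + (_ + X)) + _).
have ->: d2 = d2'.
  rewrite /d2 exchange_big; apply: eq_bigr => p _.
  exact: (sum_picks_swap D (fun y z r =>
    \sum_(E <- couplings p.2 r) F (z ++ p.1) ((y ++ x) :: E))).
(* The eight sums are grouped by the origin of the picked block: [B] alone, a matched pair, [D]
   alone. *)
rewrite [LHS](AC (1*3*(1*3)) ((1*(2*6)*(5*(3*7))*(4*8)))).
by [].
Qed.

(** The first block [x] of [A] stays alone or is prefixed by a block of a coupling of [B] and [D].
    In the second case [sum_picks_couplings] yields the three possibilities that occur when [B] is
    attached first and [D] afterwards. *)
Lemma sum_couplings_assoc A B D (F : seq block -> V) :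
  \sum_(C <- couplings A B) \sum_(G <- couplings C D) F G =
  \sum_(E <- couplings B D) \sum_(G <- couplings A E) F G.
Proof.
elim: A B D F => [|x A IH] B D F.
  by rewrite /= big_seq1; apply: eq_bigr => E _; rewrite big_seq1.
rewrite sum_couplings_cons.
under eq_bigr do rewrite sum_couplings_cons.
under [X in _ + X = _]eq_bigr => p _.
  under eq_bigr do rewrite sum_couplings_cons.
  by rewrite big_split /= exchange_big /= (IH p.2 D); over.
under [X in _ = X]eq_bigr do rewrite sum_couplings_cons.
rewrite !big_split /= (IH B D) -!addrA; congr (_ + _).
rewrite (sum_picks_couplings B D (fun y E =>
  \sum_(G <- couplings A E) F ((y ++ x) :: G))).
rewrite [LHS]addrC; congr (_ + _ + _).
  apply: eq_bigr => p _; apply: eq_bigr => q _; rewrite IH.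
  by under [RHS]eq_bigr do (under eq_bigr do rewrite -catA).
by rewrite exchange_big; apply: eq_bigr => q _; rewrite IH.
Qed.

(** A split of a coupling sends matched blocks to the same side. It thus amounts to a split of [A],
    a split of [B], and one matching on each side. *)
Lemma sum_couplings_splits A B (F : seq block -> seq block -> V) :
  \sum_(C <- couplings A B) \sum_(p <- splits C) F p.1 p.2 =
  \sum_(p <- splits A) \sum_(q <- splits B)
    \sum_(C <- couplings p.1 q.1) \sum_(D <- couplings p.2 q.2) F C D.
Proof.
elim: A B F => [|x A IH] B F.
  by rewrite /= !big_seq1; apply: eq_bigr => E _; rewrite !big_seq1.
rewrite sum_couplings_cons.
under eq_bigr do rewrite sum_splits_cons.
under [X in _ + X = _]eq_bigr => p _.
  under eq_bigr do rewrite sum_splits_cons.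
  rewrite big_split /= (IH p.2 (fun l r => F ((p.1 ++ x) :: l) r)).
  rewrite (IH p.2 (fun l r => F l ((p.1 ++ x) :: r))); over.
rewrite big_split /= (IH B (fun l r => F (x :: l) r))
  (IH B (fun l r => F l (x :: r))).
rewrite (sum_splits_cons x A (fun l r => \sum_(q <- splits B)
  \sum_(C <- couplings l q.1) \sum_(D <- couplings r q.2) F C D)).
(* The sums are sorted by the side that receives the block containing [x]. *)
rewrite big_split /= addrACA; congr (_ + _).
  rewrite [X in _ + X = _]exchange_big -big_split; apply: eq_bigr => p _ /=.
  under [RHS]eq_bigr do rewrite sum_couplings_cons.
  rewrite big_split; congr (_ + _).
  exact: (sum_picks_splitsl B (fun y l r => \sum_(C <- couplings p.1 l)
    \sum_(D <- couplings p.2 r) F ((y ++ x) :: C) D)).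
rewrite [X in _ + X = _]exchange_big -big_split; apply: eq_bigr => p _ /=.
under [RHS]eq_bigr => q _.
  under eq_bigr do rewrite sum_couplings_cons.
  rewrite big_split exchange_big /=.
  rewrite [X in _ + X]exchange_big /=; over.
rewrite big_split; congr (_ + _).
  by apply: eq_bigr => q _; rewrite exchange_big.
rewrite (sum_picks_splitsr B (fun y l r => \sum_(C <- couplings p.1 l)
    \sum_(D <- couplings p.2 r) F C ((y ++ x) :: D))).
by apply: eq_bigr => q _.
Qed.
End BlockCouplings.

(** * Relabelling, letters and number of blocks of picks, splits and couplings *)

Lemma picks_map T U (f : T -> U) s :
  picks (map f s) = [seq (f p.1, map f p.2) | p <- picks s].
Proof. by elim: s => //= x s ->; rewrite -!map_comp. Qed.

Lemma splits_map T U (f : T -> U) s :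
  splits (map f s) = [seq (map f p.1, map f p.2) | p <- splits s].
Proof. by elim: s => //= x s ->; rewrite map_cat -!map_comp. Qed.

Lemma couplings_map I J (f : I -> J) A B :
  couplings (map (map f) A) (map (map f) B) = map (map (map f)) (couplings A B).
Proof.
elim: A B => //= x A IH B; rewrite IH map_cat -!map_comp; congr (_ ++ _).
rewrite picks_map map_allpairs allpairs_mapl.
congr flatten; apply: eq_map => p /=; rewrite IH -!map_comp.
by apply: eq_map => C /=; rewrite map_cat.
Qed.

Lemma mem_picks_perm (T : eqType) (s : seq T) p :
  p \in picks s -> perm_eq (p.1 :: p.2) s.
Proof.
elim: s p => //= x s IH p; rewrite inE => /orP[/eqP-> //|/mapP[q /IH qs ->]] /=.
by rewrite (perm_catCA [:: _] [:: _]) /= perm_cons.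
Qed.

Lemma mem_picks_subseq (T : eqType) (s : seq T) p :
  p \in picks s -> subseq p.2 s.
Proof.
elim: s p => //= x s IH p; rewrite inE => /orP[/eqP->|/mapP[q /IH qs ->]] /=.
  exact: subseq_cons.
by rewrite eqxx.
Qed.

Lemma mem_splits_perm (T : eqType) (s : seq T) p :
  p \in splits s -> perm_eq (p.1 ++ p.2) s.
Proof.
elim: s p => [|x s IH] p /=; first by rewrite inE => /eqP->.
rewrite mem_cat => /orP[] /mapP[q /IH qs ->] /=; rewrite ?perm_cons //.
by rewrite (perm_catCA _ [:: x]) /= perm_cons.
Qed.

Lemma mem_splits_subseq (T : eqType) (s : seq T) p :
  p \in splits s -> subseq p.1 s && subseq p.2 s.
Proof.
elim: s p => [|x s IH] p /=; first by rewrite inE => /eqP->.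
have sub r : subseq r s -> subseq r (x :: s).
  by move=> rs; apply: (subseq_trans rs (subseq_cons _ _)).
rewrite mem_cat => /orP[] /mapP[q /IH/andP[q1 q2] ->] /=; rewrite ?eqxx.
  by rewrite q1 [X in _ && X]sub.
by rewrite q2 andbT [X in is_true X]sub.
Qed.

Lemma mem_couplings_perm (I : eqType) (A B C : seq (seq I)) :
  C \in couplings A B -> perm_eq (flatten C) (flatten A ++ flatten B).
Proof.
elim: A B C => [|x A IH] B C /=; first by rewrite inE => /eqP->.
rewrite mem_cat => /orP[/mapP[D /IH DAB ->]|].
  by rewrite /= -catA perm_cat2l.
case/allpairsPdep=> p [D [/mem_picks_perm pB /IH DAB ->]] /=.
move/perm_flatten: pB => /(perm_cat (perm_refl _)) pB.
apply: (perm_trans _ (pB _)); rewrite /= perm_sym perm_catCA -!catA.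
by rewrite !perm_cat2l perm_sym.
Qed.

Lemma mem_couplings_size (I : eqType) (A B C : seq (seq I)) :
  C \in couplings A B -> size C <= size A + size B.
Proof.
elim: A B C => [|x A IH] B C /=; first by rewrite inE => /eqP->.
rewrite mem_cat => /orP[/mapP[D /IH ? ->] //|].
case/allpairsPdep=> p [D [/mem_picks_perm/perm_size <- /IH DAB ->]] /=.
by rewrite addnS ltnS addSn leqW.
Qed.

(** The empty matching is listed first, and each matched pair lowers the number of blocks by one.
    This is the source of the leading term used for freeness. *)
Lemma couplings_lead (I : eqType) (A B : seq (seq I)) :
  exists2 s, couplings A B = (A ++ B) :: s &
    {in s, forall C, size C < size A + size B}.
Proof.
elim: A B => [|x A IH] B /=; first by exists [::].
have [s -> sP] := IH B; eexists; first by [].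
move=> C; rewrite mem_cat => /orP[/mapP[D /sP ? ->]|] //.
case/allpairsPdep=> p [D [/mem_picks_perm/perm_size <-]].
by move=> /mem_couplings_size DAB ->; rewrite /= addnS !ltnS.
Qed.

(** * Atoms as a list of blocks *)

(** The last letter of a block is compared with the block itself as well as with all later ones. The
    comparison is weak, distinctness of letters being a separate condition. Blocks are nonempty, so
    the default value of [last] does not matter. *)
Fixpoint factored (A : seq (seq nat)) : bool :=
  if A is x :: A' then
    [&& x != [::], all (leq (last 0 x)) (flatten A) & factored A']
  else true.

Lemma subseq_flatten (T : eqType) (A B : seq (seq T)) :
  subseq A B -> subseq (flatten A) (flatten B).
Proof.
elim: B A => [|y B IH] [|x A] //=; first by rewrite sub0seq.
case: eqP => [-> /IH|_ /IH AB]; first exact: cat_subseq (subseq_refl y).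
exact: subseq_trans AB (suffix_subseq _ _).
Qed.

Lemma factored_subseq A B : subseq A B -> factored B -> factored A.
Proof.
elim: B A => [|y B IH] [|x A] //=; case: eqP => [-> AB|_ AB].
  case/and3P=> -> /allP yB /(IH _ AB) ->; rewrite andbT /=.
  apply/allP => z; rewrite mem_cat => zA; apply: yB; rewrite mem_cat.
  by case/orP: zA => [-> //|/(mem_subseq (subseq_flatten AB)) ->]; rewrite orbT.
by case/and3P=> _ _ /(IH _ AB).
Qed.

Lemma factored_map f A : {in flatten A &, {mono f : x y / x <= y}} ->
  factored A -> factored (map (map f) A).
Proof.
elim: A => //= x A IH fA /and3P[x0 /allP xA /IH -> /=]; last first.
  by move=> y z yA zA; apply: fA; rewrite mem_cat ?yA ?zA orbT.
rewrite andbT; case: x x0 => //= m x _ in fA xA *.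
have mxA : last m x \in (m :: x) ++ flatten A by rewrite mem_cat mem_last.
rewrite -map_flatten last_map -map_cat.
have H z : z \in (m :: x) ++ flatten A -> f (last m x) <= f z.
  by move=> zA; rewrite fA // xA.
rewrite H ?inE ?eqxx //=; apply/allP => _ /mapP[z zA ->].
by apply: H; rewrite inE zA orbT.
Qed.

(** A block of [B] is put in front of a block [x] of [A], so the last letter of [x] stays last; it
    stays least because the letters of [B] are larger than those of [A]. *)
Lemma factored_couplings A B C : factored A -> factored B ->
    {in flatten A & flatten B, forall x y, x < y} ->
  C \in couplings A B -> factored C.
Proof.
elim: A B C => [|x A IH] B C /=; first by rewrite inE => _ ? _ /eqP->.
case/and3P=> x0 /allP xA fA fB AB.
have xx : last 0 x \in x by case: x x0 => //= m x _ in xA AB *; apply: mem_last.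
have AB' : {in flatten A & flatten B, forall x y, x < y}.
  by move=> y z yA; apply: AB; rewrite mem_cat yA orbT.
rewrite mem_cat => /orP[/mapP[D DAB ->]|/allpairsPdep[p [D [pB DAB ->]]]] /=.
  rewrite x0 (IH _ _ _ _ _ DAB) // andbT; apply/allP => z.
  rewrite mem_cat (perm_mem (mem_couplings_perm DAB)) mem_cat orbA.
  case/orP=> [zA|zB]; first by rewrite xA // mem_cat.
  by rewrite ltnW // AB // mem_cat xx.
have pB' := perm_mem (perm_flatten (mem_picks_perm pB)).
have -> : p.1 ++ x != [::] by case: (p.1).
have subp : {subset flatten p.2 <= flatten B}.
  exact/mem_subseq/subseq_flatten/mem_picks_subseq.
have -> : last 0 (p.1 ++ x) = last 0 x by rewrite last_cat; case: (x) x0.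
rewrite (IH _ _ fA _ _ DAB) ?andbT; last first.
- by move=> y z yA /subp; apply: AB'.
- exact: factored_subseq (mem_picks_subseq pB) fB.
apply/allP => z; rewrite !mem_cat (perm_mem (mem_couplings_perm DAB)) mem_cat.
have zB : z \in flatten B -> last 0 x <= z.
  by move=> zB; apply/ltnW/AB; rewrite ?mem_cat ?xx.
case/orP=> [/orP[zp|zx]|/orP[zA|/subp/zB//]].
- by apply: zB; rewrite -pB' mem_cat zp.
- by rewrite xA // mem_cat zx.
- by rewrite xA // mem_cat zA orbT.
Qed.

(** No position inside [s] is an absolute ascent, because the smaller letter [m] comes later. The
    position of [m] is one, or is the end of the word if [w] is empty. Beyond it, only the letters
    of [w] matter. *)
Lemma atom_ends_cat s m w : all (ltn m) s -> all (ltn m) w ->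
  atom_ends (rcons s m ++ w) = (size s).+1 :: map (addn (size s).+1)
    (atom_ends w).
Proof.
move=> /allP sm wm; rewrite /atom_ends size_cat size_rcons iotaD filter_cat.
have -> : iota 1 (size s).+1 = iota 1 (size s) ++ [:: (size s).+1].
  by rewrite -[X in iota 1 X]addn1 iotaD add1n.
rewrite filter_cat add1n.
rewrite (_ : filter _ (iota 1 (size s)) = [::]); last first.
  apply/eqP; rewrite -(negbK (_ == _)) -has_filter; apply/hasPn => i.
  rewrite mem_iota add1n ltnS => /andP[i0 le_i].
  rewrite negb_or -{2}[i]addn0 neq_ltn -addSn leq_add //= andbT.
  apply/negP => /andP[_ /allP/(_ m)].
  rewrite drop_cat size_rcons ltnS le_i mem_cat drop_rcons // mem_rcons inE
    eqxx.
  have lt_i : i.-1 < size s by rewrite prednK.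
  rewrite nth_cat size_rcons nth_rcons (leqW lt_i) lt_i.
  by move=> /(_ isT); rewrite ltnNge ltnW //; apply/sm/mem_nth.
rewrite cat0s /= (_ : absolute_ascent _ _ || _); last first.
  rewrite /absolute_ascent size_cat size_rcons /= drop_size_cat ?size_rcons //.
  rewrite nth_cat size_rcons leqnn nth_rcons ltnn eqxx wm andbT.
  by case: (w) => [|? ?] /=; rewrite ?addn0 ?eqxx ?orbT // addnS ltnS leq_addr.
rewrite /= (_ : iota _ (size w) = map (addn (size s).+1) (iota 1 (size w)));
  last first.
  by rewrite -iotaDl addn1.
rewrite filter_map; congr (_ :: map _ _); apply: eq_in_filter => i.
rewrite mem_iota add1n ltnS => /andP[i0 le_i] /=.
rewrite eqn_add2l; congr (_ || _); rewrite /absolute_ascent.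
rewrite size_cat size_rcons ltn_add2l.
have -> : drop ((size s).+1 + i) (rcons s m ++ w) = drop i w.
  by rewrite -(size_rcons s m) addnC -drop_drop drop_size_cat.
case: i i0 {le_i} => // i _; rewrite addnS /= nth_cat size_rcons.
by rewrite [_ + i < _]ltnNge leq_addr /= addKn.
Qed.

Lemma atoms_cat s m w : all (ltn m) s -> all (ltn m) w ->
  atoms (rcons s m ++ w) = rcons s m :: atoms w.
Proof.
move=> sm wm; rewrite /atoms atom_ends_cat //= subn0 -(size_rcons s m).
rewrite take_size_cat // drop_size_cat //; congr (_ :: reshape _ _).
(* Successive differences do not see a common shift of the end positions. *)
rewrite -[X in pairmap _ X]addn0; move: (size (rcons s m)) 0 => k j.
by elim: (atom_ends w) j => //= i l IH j; rewrite subnDl IH.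
Qed.

Lemma factored_head x A : uniq (flatten (x :: A)) -> factored (x :: A) ->
  exists s m, [/\ x = rcons s m, all (ltn m) s & all (ltn m) (flatten A)].
Proof.
case/lastP: x => [|s m] //= + /and3P[_ + _].
rewrite last_rcons cat_rcons -[m :: _]cat1s uniq_catCA /=.
move=> /andP[ms _] /allP sm; exists s, m.
have lt_m z : z \in s ++ flatten A -> ltn m z.
  move=> zA; rewrite /= ltn_neqAle sm ?andbT.
    by apply: contraNneq ms => ->.
  by move: zA; rewrite !mem_cat inE orbCA => ->; rewrite orbT.
by split=> //; apply/allP => z zs; apply: lt_m; rewrite mem_cat zs ?orbT.
Qed.

(** By induction, the first atom is cut off after the least letter of the word. Words can therefore
    be replaced by lists of blocks from here on. *)
Lemma atoms_flatten A : uniq (flatten A) -> factored A -> atoms (flatten A) = A.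
Proof.
elim: A => // x A IH uA fA; have [s [m [xE sm Am]]] := factored_head uA fA.
rewrite xE /= atoms_cat ?IH //; last by case/and3P: fA.
by move: uA; rewrite /= cat_uniq => /and3P[].
Qed.

(** By [atoms_flatten], any factored list with this word will do. Its first block ends at a least
    letter of the word, and induction treats the rest. *)
Lemma factored_atoms a : uniq a -> factored (atoms a).
Proof.
suff [A fA <-]: exists2 A, factored A & flatten A = a.
  by move=> ua; rewrite atoms_flatten.
elim: {a}(size a) {-2}a (leqnn (size a)) => [|n IH] [|y a'] //;
  try by exists [::].
set a := y :: a' => le_a.
have [m ma min_m] : exists2 m, m \in a & all (leq m) a.
  case: (@arg_minnP _ ord0 predT (fun i : 'I_(size a) => nth 0 a i)) => // i _
    iP.
  exists (nth 0 a i); first exact: mem_nth.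
  by apply/(all_nthP 0) => j ja; apply: (iP (Ordinal ja)).
case/splitPr: ma min_m le_a => s w min_m; rewrite size_cat addnS ltnS => le_n.
have [A fA Aw] := IH w (leq_trans (leq_addl _ _) le_n).
exists (rcons s m :: A); rewrite /= Aw ?cat_rcons // last_rcons fA min_m.
by case: (s).
Qed.

(** * Sums over index sets as sums over lists *)

Section TupleSums.
Local Open Scope ring_scope.
Variables (V : nmodType) (X : finType).

Lemma sum_tuple0 (P : pred (seq X)) (F : seq X -> V) :
  \sum_(t : 0.-tuple X | P t) F t = if P [::] then F [::] else 0.
Proof.
rewrite big_mkcond (big_pred1 [tuple]) // => t /=.
by apply/esym/eqP; rewrite tuple0.
Qed.

Lemma sum_tuple_cons n (P : pred (seq X)) (F : seq X -> V) :
  \sum_(t : n.+1.-tuple X | P t) F t =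
  \sum_(x : X) \sum_(t : n.-tuple X | P (x :: t)) F (x :: t).
Proof.
rewrite pair_big_dep (reindex (fun p : X * n.-tuple X => [tuple of p.1 :: p.2])) //=.
exists (fun t => (thead t, [tuple of behead t])) => [[x t]|t] _.
  by rewrite /= theadE; congr (_, _); apply: val_inj.
by apply: val_inj; case/tupleP: t => x t; rewrite /= theadE.
Qed.

Lemma sum_option (F : option X -> V) :
  \sum_x F x = F None + \sum_x F (Some x).
Proof.
rewrite (bigD1 None) //=; congr (_ + _).
rewrite (reindex_omap Some id) /=; last by case.
by apply: eq_bigl => x; rewrite eqxx.
Qed.

End TupleSums.

Lemma picks_uniq (T : eqType) (s : seq T) : uniq s ->
  picks s = [seq (x, rem x s) | x <- s].
Proof.
elim: s => //= x s IH /andP[xs us]; rewrite eqxx IH // -map_comp.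
congr (_ :: _); apply/eq_in_map => y ys /=.
by case: eqP xs => // ->; rewrite ys.
Qed.

Section WordSums.
Local Open Scope ring_scope.
Variable V : nmodType.

Lemma select_atoms_mask (a : seq nat) (t : (num_atoms a).-tuple bool) :
  select_atoms [set i | tnth t i] = flatten (mask t (atoms a)).
Proof.
rewrite /select_atoms /atom.
under eq_bigl do rewrite inE (tnth_nth false).
case: t => t /= /eqP; elim: (atoms a) t => [|x A IH] [|b t] //=.
  by rewrite big_ord0.
case=> /IH IHt; rewrite big_mkcond big_ord_recl /=.
by case: b; rewrite /= -IHt [in RHS]big_mkcond.
Qed.

(** A set of atoms is encoded by its characteristic tuple of booleans, and its complement by the
    negated tuple. Recursion on tuples of booleans is the recursion of [splits]. *)
Lemma sum_select_atoms (a : seq nat) (F : seq nat -> seq nat -> V) :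
  \sum_(J : {set 'I_(num_atoms a)}) F (select_atoms J) (select_atoms (~: J)) =
  \sum_(p <- splits (atoms a)) F (flatten p.1) (flatten p.2).
Proof.
rewrite (reindex (fun t : (num_atoms a).-tuple bool => [set i | tnth t i])) /=;
  last first.
  exists (fun J : {set _} => [tuple i \in J | i < num_atoms a]) => [t|J] _.
    by apply: eq_from_tnth => i; rewrite tnth_mktuple inE.
  by apply/setP => i; rewrite inE tnth_mktuple.
pose G (t : seq bool) :=
  F (flatten (mask t (atoms a))) (flatten (mask (map negb t) (atoms a))).
transitivity (\sum_(t : (num_atoms a).-tuple bool) G t).
  apply: eq_bigr => t _; rewrite select_atoms_mask; congr F.
  rewrite -[map negb t]/(tval [tuple of map negb t]) -select_atoms_mask.
  by congr select_atoms; apply/setP => i; rewrite !inE tnth_map.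
rewrite {}/G; elim: (atoms a) F => [|x A IH] F.
  rewrite (sum_tuple0 xpredT (fun t : seq bool =>
    F (flatten (mask t [::])) (flatten (mask (map negb t) [::])))).
  by rewrite big_seq1.
rewrite (sum_tuple_cons _ xpredT (fun t : seq bool =>
  F (flatten (mask t (x :: A))) (flatten (mask (map negb t) (x :: A))))).
rewrite big_bool (sum_splits_cons x A (fun l r => F (flatten l) (flatten r)))
  /=.
by rewrite (IH (fun u v => F (x ++ u) v)) (IH (fun u v => F u (x ++ v))).
Qed.

(* [o] lists the values of a partial injection, with [None] off its domain. *)
Fixpoint attach (X : Type) (g : X -> seq nat) (o : seq (option X))
    (A : seq (seq nat)) : seq (seq nat) :=
  match o, A with
  | c :: o', x :: A' =>
      (if c is Some t then g t ++ x else x) :: attach g o' A'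
  | _, _ => [::]
  end.

(** [J] lists the indices still available; it is arbitrary because the induction on [A] removes from
    it the index used by the first block. *)
Lemma sum_partial_injections (X : finType) (g : X -> seq nat) (J : seq X)
    (A : seq (seq nat)) (F : seq (seq nat) -> V) : uniq J ->
  \sum_(o : (size A).-tuple (option X) |
        uniq (pmap id o) && all (mem J) (pmap id o))
     F (attach g o A ++ [seq g t | t <- J & Some t \notin o]) =
  \sum_(C <- couplings A (map g J)) F C.
Proof.
elim: A J F => [|x A IH] J F uJ.
  rewrite (sum_tuple0 (fun o => uniq (pmap id o) && all (mem J) (pmap id o))
    (fun o => F (attach g o [::] ++ [seq g t | t <- J & Some t \notin o]))) /=.
  by rewrite big_seq1; congr F; congr map; apply/all_filterP/allP.
rewrite (sum_tuple_cons _ (fun o => uniq (pmap id o) && all (mem J) (pmap id o))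
    (fun o => F (attach g o (x :: A) ++ [seq g t | t <- J & Some t \notin o]))) /=.
rewrite sum_option sum_couplings_cons -(IH J (fun C => F (x :: C))) //=.
congr (_ + _); rewrite picks_map picks_uniq // !big_map /= [RHS]big_uniq //=.
rewrite [RHS]big_mkcond; apply: eq_bigr => t _.
case: ifPn => tJ; last first.
  by apply: big_pred0 => o; rewrite andbF.
have ut : uniq (rem t J) by rewrite rem_uniq.
rewrite -[RHS](IH _ (fun C => F ((g t ++ x) :: C)) ut).
(* As [J] has distinct entries, taking values in [J] and avoiding [t] means taking values in
   [rem t J]. *)
apply: eq_big => [o|o _].
  case: (uniq (pmap id o)); rewrite ?andbF //= andbT.
  elim: (pmap id o) => //= u s IHs; rewrite inE negb_or -IHs.
  rewrite (mem_rem_uniq t uJ) !inE [t == u]eq_sym.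
  by case: (u == t); case: (u \in J); case: (t \in s).
congr (F (_ :: _ ++ map g _)); rewrite rem_filter // -filter_predI.
by apply: eq_filter => u; rewrite /= inE negb_or andbC; congr (_ && ~~ _).
Qed.

End WordSums.

(** This translates the condition [partial_injective] on functions into a condition on the list of
    their values. *)
Lemma uniq_pmapP (T : eqType) (s : seq (option T)) :
  reflect (forall i j, i < size s -> j < size s -> nth None s i != None ->
             nth None s i = nth None s j -> i = j)
          (uniq (pmap id s)).
Proof.
have memP x r : reflect (exists2 i, i < size r & nth None r i = Some x)
                        (x \in pmap id r).
  rewrite mem_pmap map_id; exact: (iffP (nthP None)).
elim: s => [|[x|] s IH] /=; first by constructor.
- apply: (iffP andP) => [[xs /IH us]|us].
    case=> [|i] [|j] //= lti ltj; last by move=> ? /us->.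
      by move=> _ xE; case/memP: xs; exists j.
    by move=> _ xE; case/memP: xs; exists i.
  split; last by apply/IH => i j lti ltj si sij;
    have [] := us i.+1 j.+1 lti ltj si sij.
  by apply/memP => [[i lti xE]]; have := us 0 i.+1 isT lti isT (esym xE).
- apply: (iffP IH) => us; last by move=> i j lti ltj si sij;
  have [] := us i.+1 j.+1 lti ltj si sij.
  by case=> [|i] [|j] //= lti ltj si sij;
    [move: si; rewrite sij | rewrite (us i j)].
Qed.

Lemma big_cat_flatten (I T : Type) (r : seq I) (P : pred I) (F : I -> seq T) :
  \big[cat/[::]]_(i <- r | P i) F i = flatten [seq F i | i <- r & P i].
Proof.
rewrite -big_filter; elim: (filter P r) => [|i s IH]; first by rewrite big_nil.
by rewrite big_cons IH.
Qed.

Lemma map_atom (a : seq nat) : [seq atom a i | i <- enum 'I_(num_atoms a)] =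
  atoms a.
Proof.
rewrite -[RHS](mkseq_nth [::]) /mkseq -val_enum_ord -map_comp.
exact: eq_map.
Qed.

Lemma sum_couple_word (V : nmodType) (a b : seq nat) n (F : seq nat -> V) :
  (\sum_(f : partial_injection (num_atoms a) (num_atoms b)) F (couple_word n f) =
   \sum_(C <- couplings (atoms a) (map (shift n) (atoms b))) F (flatten C))%R.
Proof.
(* The word makes sense for every function, injective or not, so the sum over a subtype becomes a
   sum restricted by a predicate. *)
pose word (h : {ffun 'I_(num_atoms a) -> option 'I_(num_atoms b)}) :=
  \big[cat/[::]]_(i < num_atoms a)
     (if h i is Some t then shift n (atom b t) ++ atom a i else atom a i) ++
  \big[cat/[::]]_(t < num_atoms b | Some t \notin codom h) shift n (atom b t).
rewrite -(big_sub (@partial_injective _ _) (fun h => F (word h))).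
pose ff (o : (num_atoms a).-tuple (option 'I_(num_atoms b))) :=
  [ffun i => tnth o i].
rewrite (reindex ff) /=; last first.
  exists (fun h : {ffun _} => [tuple h i | i < num_atoms a]) => [t|h] _.
    by apply: eq_from_tnth => i; rewrite tnth_mktuple ffunE.
  by apply/ffunP => i; rewrite ffunE tnth_mktuple.
rewrite -[in RHS](map_atom b) -map_comp -sum_partial_injections ?enum_uniq //=.
apply: eq_big => [o|o _].
  have -> : all (mem (enum 'I_(num_atoms b))) (pmap id o).
    by apply/allP => t _; rewrite /= mem_enum.
  rewrite andbT; apply/forallP/uniq_pmapP => [oI i j|oI i].
    rewrite size_tuple => lti ltj.
    have /forallP/(_ (Ordinal ltj))/implyP := oI (Ordinal lti).
    rewrite !ffunE !(tnth_nth None) /= => oij oi0 oijE.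
    suff /eqP/(congr1 val) : Ordinal lti == Ordinal ltj by [].
    by apply: oij; rewrite oi0 oijE /=.
  apply/forallP => j; apply/implyP; rewrite !ffunE !(tnth_nth None).
  by case/andP=> oi0 /eqP oij; apply/eqP/val_inj/oI;
    rewrite ?size_tuple ?ltn_ord.
congr F; rewrite flatten_cat /word; congr (_ ++ _).
  under eq_bigr do rewrite ffunE (tnth_nth None) /atom.
  case: o => o /= /eqP; elim: (atoms a) o => [|x A IH] [|c o] //=.
    by rewrite big_ord0.
  by case=> /IH <-; rewrite big_ord_recl /=; case: c.
rewrite big_cat_flatten; congr (flatten (map _ _)).
rewrite /index_enum -enumT; apply: eq_filter => t; congr (~~ _).
by apply/codomP/tnthP => -[i iE]; exists i; rewrite ffunE in iE *.
Qed.

(** * Linear algebra on bases *)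

Section Linear.
Local Open Scope ring_scope.
Variable K : fieldType.

(** The Hopf algebra axioms express linearity as a proposition; packing the map into a linear
    structure gives access to the general rules. *)
Lemma linear_sum_prop (V W : lmodType K) (f : V -> W) (I : Type) (r : seq I)
    (P : pred I) (F : I -> V) : linear f ->
  f (\sum_(i <- r | P i) F i) = \sum_(i <- r | P i) f (F i).
Proof.
move=> fL;
  pose g : {linear V -> W} := HB.pack f (GRing.isLinear.Build _ _ _ _ f fL).
exact: (linear_sum g).
Qed.

Lemma linearZ_prop (V W : lmodType K) (f : V -> W) c u : linear f ->
  f (c *: u) = c *: f u.
Proof.
move=> fL;
  pose g : {linear V -> W} := HB.pack f (GRing.isLinear.Build _ _ _ _ f fL).
exact: (linearZ_LR g).
Qed.

Lemma linearB_prop (V W : lmodType K) (f : V -> W) u v : linear f ->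
  f (u - v) = f u - f v.
Proof.
move=> fL;
  pose g : {linear V -> W} := HB.pack f (GRing.isLinear.Build _ _ _ _ f fL).
exact: (linearB g).
Qed.

Lemma linear0_prop (V W : lmodType K) (f : V -> W) : linear f -> f 0 = 0.
Proof. by move=> fL; rewrite -[X in f X](subrr 0) linearB_prop // subrr. Qed.

Variable B : choiceType.
Local Notation V := {malg K[B]}.

Lemma malg_sumE (u : V) : u = \sum_(b <- msupp u) u@_b *: << b >>.
Proof.
apply/malgP => k; rewrite raddf_sum /= -[LHS]mulr1.
under eq_bigr do rewrite mcoeffZ mcoeffU.
case: (boolP (k \in msupp u)) => ku.
  rewrite (big_fsetD1 k) //= eqxx big1_fset ?addr0 // => b.
  by rewrite in_fsetD1 => /andP[/negbTE-> _] _; rewrite mulr0.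
rewrite mcoeff_outdom // mul0r big1_fset // => b bu _.
by case: eqP => [bk|_]; [rewrite -bk bu in ku | rewrite mulr0].
Qed.

Variable W : lmodType K.
Implicit Types (f g : B -> W).

(** A common finite index set allows the extensions of several vectors to be added term by term. *)
Lemma lin_extw f (D : {fset B}) (u : V) : (msupp u `<=` D)%fset ->
  lin_ext f u = \sum_(b <- D) u@_b *: f b.
Proof.
move=> uD; rewrite /lin_ext; apply: big_fset_incl => // b _ bu.
by rewrite mcoeff_outdom // scale0r.
Qed.

Lemma lin_ext_linear f : linear (lin_ext f : V -> W).
Proof.
move=> c u v; set D := (msupp u `|` msupp v)%fset.
rewrite !(@lin_extw f D) ?fsubsetUl ?fsubsetUr //; last first.
  apply: fsubset_trans (msuppD_le _ _) _.
  by apply: fsetUSS; rewrite ?msuppZ_le.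
rewrite scaler_sumr -big_split; apply: eq_bigr => b _ /=.
by rewrite mcoeffD mcoeffZ scalerDl scalerA.
Qed.

HB.instance Definition _ f :=
  GRing.isLinear.Build K V W _ (lin_ext f) (lin_ext_linear f).

Lemma lin_extU f b : lin_ext f (<< b >> : V) = f b.
Proof.
by rewrite /lin_ext msuppU oner_eq0 big_seq_fset1 mcoeffUU scale1r.
Qed.

Lemma eq_lin_ext f g (u : V) : f =1 g -> lin_ext f u = lin_ext g u.
Proof. by move=> fg; apply: eq_bigr => b _; rewrite fg. Qed.

Lemma lin_ext_eq (h : V -> W) (u : V) : linear h ->
  h u = lin_ext (fun b => h << b >>) u.
Proof.
move=> hL; rewrite {1}[u]malg_sumE linear_sum_prop //.
by apply: eq_bigr => b _; rewrite linearZ_prop.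
Qed.

Lemma eq_linear (h k : V -> W) : linear h -> linear k ->
  (forall b, h << b >> = k << b >>) -> h =1 k.
Proof.
by move=> hL kL hk u; rewrite lin_ext_eq // [RHS]lin_ext_eq //;
  apply: eq_lin_ext.
Qed.

Lemma linear_lin_ext (U : lmodType K) (h : W -> U) f (u : V) : linear h ->
  h (lin_ext f u) = lin_ext (fun b => h (f b)) u.
Proof.
move=> hL; rewrite /lin_ext linear_sum_prop //; apply: eq_bigr => b _.
exact: linearZ_prop.
Qed.

Lemma linear_comp (U : lmodType K) (h : W -> U) (k : V -> W) :
  linear h -> linear k -> linear (h \o k).
Proof. by move=> hL kL c u v /=; rewrite kL hL. Qed.

Lemma lin_ext_fun_linear (U : lmodType K) (F : U -> B -> W) (u : V) :
  (forall b, linear (F ^~ b)) -> linear (fun x => lin_ext (F x) u).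
Proof.
move=> FL c x y; rewrite /lin_ext scaler_sumr -big_split; apply: eq_bigr => b _.
by rewrite /= FL scalerDr !scalerA mulrC.
Qed.
End Linear.

Section Tensor.
Local Open Scope ring_scope.
Variables (K : fieldType).

Lemma tensorU (B C : choiceType) (b : B) (c : C) :
  tensor (<< b >> : {malg K[B]}) (<< c >> : {malg K[C]}) = << (b, c) >>.
Proof. by rewrite /tensor !lin_extU. Qed.

Lemma tensor_linearl (B C : choiceType) (v : {malg K[C]}) :
  linear (fun u : {malg K[B]} => tensor u v).
Proof. exact: lin_ext_linear. Qed.

Lemma tensor_linearr (B C : choiceType) (u : {malg K[B]}) :
  linear (tensor u : {malg K[C]} -> _).
Proof. by apply: lin_ext_fun_linear => b; apply: lin_ext_linear. Qed.

End Tensor.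

(** * Unitriangular linear maps are bijective *)

Section Triangular.
Local Open Scope ring_scope.
Variables (K : fieldType) (X P : choiceType) (beta : X -> P) (rk : P -> nat).
Variable phi : {malg K[X]} -> {malg K[P]}.
Hypothesis phi_linear : linear phi.
Hypothesis beta_bij : bijective beta.
Hypothesis phi_lead : forall x b,
  b \in msupp (phi << x >> - << beta x >>) -> (rk b < rk (beta x))%N.

Lemma msupp_lin_ext (B C : choiceType) (f : B -> {malg K[C]})
  (u : {malg K[B]}) c :
  c \in msupp (lin_ext f u) -> exists2 b, b \in msupp u & c \in msupp (f b).
Proof.
move=> cu;
  have [/hasP[b bu cb]|/hasPn H] := boolP
    (has (fun b => c \in msupp (f b)) (msupp u)).
  by exists b.
move: cu;
  rewrite -mcoeff_neq0 /lin_ext raddf_sum big1_seq ?eqxx // => b /andP[_ bu] /=.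
by rewrite mcoeffZ [X in _ * X]mcoeff_outdom ?mulr0 //; apply: H.
Qed.

Let tail u := lin_ext (fun x => phi << x >> - << beta x >>) u.

Lemma triangular_decomp u : phi u = lin_ext (fun x => << beta x >>) u + tail u.
Proof.
rewrite lin_ext_eq // /tail /lin_ext -big_split; apply: eq_bigr => b _ /=.
by rewrite -scalerDr addrC subrK.
Qed.

(** Let [x] be of greatest rank in the support of a kernel vector. All tails have smaller rank, so
    the coefficient of [beta x] in the image is that of [x], which must vanish. The bound on the
    ranks thus descends to zero. *)
Lemma triangular_inj : injective phi.
Proof.
move=> u v uv; apply/eqP; rewrite -subr_eq0; apply/eqP.
have : phi (u - v) = 0 by rewrite linearB_prop // uv subrr.
move: (u - v) => {uv v} {}u u0.
have [n] : exists n, forall x, x \in msupp u -> (rk (beta x) < n)%N.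
  exists (\max_(x <- msupp u) (rk (beta x)).+1)%N => x xu.
  by apply: (@leq_bigmax_seq _ _ xpredT (fun x => (rk (beta x)).+1)).
elim: n => [|n IH] lt_n.
  apply/malgP => x; rewrite mcoeff0; apply/mcoeff_outdom/negP => /lt_n.
  by rewrite ltn0.
apply: IH => x xu; rewrite ltn_neqAle -ltnS lt_n // andbT; apply/eqP => xn.
have := congr1 (mcoeff (beta x)) u0; rewrite triangular_decomp mcoeffD mcoeff0.
rewrite [(tail _)@_ _]mcoeff_outdom ?addr0; last first.
  apply/negP => /msupp_lin_ext[y /lt_n yn /phi_lead].
  by rewrite xn ltnNge -ltnS yn.
rewrite /lin_ext raddf_sum (big_fsetD1 x) //= mcoeffZ mcoeffUU mulr1.
rewrite big1_fset ?addr0 => [/eqP|y]; first by rewrite mcoeff_eq0 xu.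
rewrite in_fsetD1 => /andP[yx _] _; rewrite mcoeffZ mcoeffU.
by rewrite (inj_eq (bij_inj beta_bij)) (negbTE yx) mulr0.
Qed.

(** For surjectivity, [v] is pulled back along the bijection of bases; the error is a tail of
    smaller rank, whose preimage exists by induction and is subtracted. *)
Lemma triangular_bij : bijective phi.
Proof.
have [gamma betaK gammaK] := beta_bij.
have phi_surj v : exists u, phi u == v.
  have [n] : exists n, forall b, b \in msupp v -> (rk b < n)%N.
    exists (\max_(b <- msupp v) (rk b).+1)%N => b bv.
    by apply: (@leq_bigmax_seq _ _ xpredT (fun b => (rk b).+1)).
  elim: n v => [|n IH] v lt_n.
    exists 0; apply/eqP/malgP => b.
    rewrite -[0](subrr 0) linearB_prop // subrr mcoeff0.
    by apply/esym/mcoeff_outdom/negP => /lt_n; rewrite ltn0.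
  pose u := lin_ext (fun b => << gamma b >>) v : {malg K[X]}.
  have uE : lin_ext (fun x => << beta x >>) u = v.
    rewrite /u linear_lin_ext; last exact: lin_ext_linear.
    rewrite [RHS]malg_sumE; apply: eq_bigr => b _.
    by rewrite lin_extU gammaK.
  have [b|w /eqP wE] := IH (tail u).
    case/msupp_lin_ext => x /msupp_lin_ext[c /lt_n cn].
    rewrite msuppU oner_eq0 in_fset1 => /eqP-> /phi_lead.
    by rewrite gammaK => bc; apply: leq_trans bc _.
  by exists (u - w); rewrite linearB_prop // wE triangular_decomp uE addrK.
exists (fun v => xchoose (phi_surj v)) => [u|v].
  exact/triangular_inj/eqP/(xchooseP (phi_surj (phi u))).
exact/eqP/(xchooseP (phi_surj v)).
Qed.
End Triangular.

(** * Standardization *)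

(** The relabelling that [standardize] applies to [w], named so that it can be applied to the blocks
    of [w] separately. *)
Definition rank (w : seq nat) (x : nat) := count (fun y => y <= x) w.

Lemma rank_mono w : {in w &, {mono rank w : x y / x <= y}}.
Proof.
have lt_rank x y : y \in w -> x < y -> rank w x < rank w y.
  elim: w => //= z w IH; rewrite inE /rank /= => /orP[/eqP-> xz|yw xy].
    rewrite leqnn [z <= x]leqNgt xz add0n add1n ltnS.
    by apply: sub_count => t /= tx; apply: leq_trans tx (ltnW xz).
  rewrite -addnS leq_add //; last exact: IH.
  by case: (leqP z x) => // zx; rewrite (leq_trans zx (ltnW xy)).
move=> x y xw yw; case: (leqP x y) => [|yx].
  by rewrite leq_eqVlt => /orP[/eqP->|/lt_rank/ltnW]; rewrite ?leqnn //; apply.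
by apply/negbTE; rewrite -ltnNge lt_rank.
Qed.

Lemma standardize_map f w : {in w &, {mono f : x y / x <= y}} ->
  standardize (map f w) = standardize w.
Proof.
move=> fw; rewrite /standardize -map_comp; apply/eq_in_map => x xw /=.
by rewrite count_map; apply: eq_in_count => y yw /=; apply: fw.
Qed.

Lemma standardize_permutation (a : permutation) : standardize a = a.
Proof.
case: a => a /= aP; rewrite /standardize -[RHS]map_id; apply/eq_in_map => x.
rewrite (perm_mem aP) mem_iota add1n ltnS => /andP[x0 xn].
rewrite (permP aP) -(subnKC xn) iotaD count_cat.
rewrite [X in X + _](_ : _ = x); last first.
  rewrite -[RHS](size_iota 1); apply/eqP; rewrite -all_count; apply/allP => y.
  by rewrite mem_iota add1n ltnS => /andP[].
rewrite -[RHS]addn0; congr (_ + _); apply/eqP; rewrite -leqn0 leqNgt -has_count.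
by apply/hasPn => y; rewrite mem_iota add1n => /andP[] /=; rewrite ltnNge.
Qed.

(** A total function, with the empty permutation as value on words with repeated letters, so that
    sums need not carry proofs of distinctness. *)
Definition standard (w : seq nat) : permutation :=
  insubd empty_permutation (standardize w).

Lemma val_standard w : uniq w -> val (standard w) = standardize w.
Proof. by move=> uw; rewrite val_insubd standardize_subproof. Qed.

Lemma standardK (a : permutation) : standard a = a.
Proof.
by apply: val_inj;
  rewrite val_standard ?uniq_permutation ?standardize_permutation.
Qed.

Lemma standard_map f w : {in w &, {mono f : x y / x <= y}} ->
  standard (map f w) = standard w.
Proof. by move=> fw; rewrite /standard standardize_map. Qed.

Lemma size_standard w : uniq w -> size (standard w) = size w.
Proof. by move=> uw; rewrite val_standard // size_map. Qed.

Lemma draw_partE (a : permutation) (J : {set 'I_(num_atoms a)}) :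
  draw_part J = standard (select_atoms J).
Proof. by apply: val_inj; rewrite val_standard ?uniq_select_atoms. Qed.

Lemma coupleE (a b : permutation)
  (f : partial_injection (num_atoms a) (num_atoms b)) :
  couple f = standard (couple_word (degree a) f).
Proof. by rewrite -[LHS]standardK. Qed.

(** * Factorizations and the permutations they represent *)

Definition factorization A := uniq (flatten A) && factored A.

Lemma factorization_atoms (a : permutation) : factorization (atoms a).
Proof.
by rewrite /factorization flatten_atoms uniq_permutation factored_atoms
  ?uniq_permutation.
Qed.

Lemma factorization_splits A p : factorization A -> p \in splits A ->
  factorization p.1 && factorization p.2.
Proof.
case/andP=> uA fA /mem_splits_subseq/andP[p1 p2]; rewrite /factorization.
rewrite !(subseq_uniq (subseq_flatten _) uA) //.
by rewrite (factored_subseq p1) ?(factored_subseq p2).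
Qed.

Lemma factorization_couplings A B C : factorization A -> factorization B ->
    {in flatten A & flatten B, forall x y, x < y} ->
  C \in couplings A B -> factorization C.
Proof.
case/andP=> uA fA /andP[uB fB] AB CAB; rewrite /factorization.
rewrite (factored_couplings fA fB AB CAB) (perm_uniq (mem_couplings_perm CAB)).
rewrite cat_uniq uA uB !andbT; apply/hasPn => x xB; apply/negP => xA.
by have := AB _ _ xA xB; rewrite ltnn.
Qed.

(** Since only the relative order of the letters matters, the same permutation has representatives
    on many alphabets; the factors of a product can be placed on disjoint ranges. *)
Definition assemble (A : seq (seq nat)) : permutation := standard (flatten A).

Lemma assemble_map f A : {in flatten A &, {mono f : x y / x <= y}} ->
  assemble (map (map f) A) = assemble A.
Proof. by move=> fA; rewrite /assemble -map_flatten standard_map. Qed.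

Lemma degree_assemble A : factorization A -> degree (assemble A) = size
  (flatten A).
Proof. by case/andP=> uA _; rewrite /degree size_standard. Qed.

Lemma degree_eq0 (a : permutation) : (degree a == 0) = (a == empty_permutation).
Proof. by rewrite /degree size_eq0 -val_eqE. Qed.

Lemma assemble_nil : assemble [::] = empty_permutation.
Proof. exact: (standardK empty_permutation). Qed.

Lemma assemble_eq_nil A : factorization A ->
  (assemble A == empty_permutation) = nilp A.
Proof.
move=> fA; rewrite -degree_eq0 degree_assemble //.
by case/andP: fA => _; case: A => [|[|x s] A].
Qed.

Lemma factorization_map f A : {in flatten A &, {mono f : x y / x <= y}} ->
  factorization A -> factorization (map (map f) A).
Proof.
move=> fA /andP[uA factA]; rewrite /factorization factored_map // andbT.
rewrite -map_flatten map_inj_in_uniq // => x y xA yA xy.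
by apply/eqP; rewrite eqn_leq -(fA x y) // -(fA y x) // xy leqnn.
Qed.

Lemma atoms_standard A : factorization A ->
  atoms (standard (flatten A)) = map (map (rank (flatten A))) A.
Proof.
move=> fA; case/andP: (fA) => uA _.
rewrite val_standard // /standardize map_flatten.
have /andP[uA' fA'] := factorization_map (@rank_mono (flatten A)) fA.
exact: atoms_flatten.
Qed.

Lemma mem_permutation (a : permutation) x : (x \in word a) = (0 < x <= size a).
Proof. by case: a => a /= /perm_mem->; rewrite mem_iota add1n ltnS. Qed.

(** The bound [n] serves to place a permutation on letters above those of a previous factor. *)
Lemma assemble_surj (a : permutation) n :
  exists A, [/\ factorization A, all (ltn n) (flatten A) & a = assemble A].
Proof.
have shift_mono : {mono addn^~ n : x y / x <= y} by move=> x y;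
  rewrite leq_add2r.
exists (map (map (addn^~ n)) (atoms a)); split.
- by apply: factorization_map (factorization_atoms a) => x y _ _.
- rewrite -map_flatten flatten_atoms; apply/allP => _ /mapP[x xa ->].
  by move: xa; rewrite mem_permutation => /andP[x0 _];
    rewrite /= -add1n leq_add2r.
- by rewrite assemble_map => [|x y _ _] //;
  rewrite /assemble flatten_atoms standardK.
Qed.

(** * Product and coproduct of basis vectors as sums over lists of blocks *)

Section Vectors.
Local Open Scope ring_scope.
Variable K : fieldType.
Local Notation KS := {malg K[permutation]}.

Lemma coupling_productU (a b : permutation) :
  coupling_product (<< a >> : KS) << b >> =
  \sum_(C <- couplings (atoms a) (map (shift (degree a)) (atoms b)))
     << assemble C >>.
Proof.
rewrite /coupling_product !lin_extU.
under eq_bigr do rewrite coupleE.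
exact: (sum_couple_word a b (degree a) (fun w => << standard w >> : KS)).
Qed.

Lemma draw_coproductU (a : permutation) :
  draw_coproduct (<< a >> : KS) =
  \sum_(p <- splits (atoms a)) << (assemble p.1, assemble p.2) >>.
Proof.
rewrite /draw_coproduct lin_extU.
under eq_bigr do rewrite !draw_partE.
exact: (sum_select_atoms a (fun l r => << (standard l, standard r) >> : {malg K[_]})).
Qed.

(** Couplings commute with order-preserving relabelling, so the prescribed shift of the second
    factor can be replaced by any larger letters. *)
Lemma coupling_product_blocks A B : factorization A -> factorization B ->
    {in flatten A & flatten B, forall x y, (x < y)%N} ->
  coupling_product (<< assemble A >> : KS) << assemble B >> =
  \sum_(C <- couplings A B) << assemble C >>.
Proof.
move=> fA fB AB; rewrite coupling_productU !atoms_standard //.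
(* Both factors are relabelled by the rank in the joint word. On [A] the letters of [B] do not
   count; on [B] all letters of [A] count and produce the shift by the degree. *)
pose w := flatten A ++ flatten B.
have -> : map (map (rank (flatten A))) A = map (map (rank w)) A.
  apply/eq_in_map => s sA; apply/eq_in_map => x xs.
  have xA : x \in flatten A by apply/flattenP; exists s.
  rewrite /rank count_cat [X in (_ + X)%N](_ : _ = 0%N) ?addn0 //.
  apply/eqP; rewrite -leqn0 leqNgt -has_count; apply/hasPn => y yB.
  by rewrite -ltnNge AB.
have -> : map (shift (degree (standard (flatten A))))
  (map (map (rank (flatten B))) B) =
          map (map (rank w)) B.
  rewrite -map_comp; apply/eq_in_map => s sB; rewrite /= /shift -map_comp.
  apply/eq_in_map => y ys; have yB : y \in flatten B by apply/flattenP;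
    exists s.
  rewrite /= /rank count_cat addnC; congr (_ + _)%N.
  rewrite /degree size_standard; last by case/andP: fA.
  by apply/esym/eqP; rewrite -all_count; apply/allP => x xA; rewrite ltnW ?AB.
rewrite couplings_map big_map; apply: eq_big_seq => C CAB.
congr << _ >>; apply: assemble_map => x y;
  rewrite !(perm_mem (mem_couplings_perm CAB)).
exact: rank_mono.
Qed.

Lemma draw_coproduct_blocks A : factorization A ->
  draw_coproduct (<< assemble A >> : KS) =
  \sum_(p <- splits A) << (assemble p.1, assemble p.2) >>.
Proof.
move=> fA; rewrite draw_coproductU atoms_standard // splits_map big_map.
apply: eq_big_seq => p /mem_splits_subseq/andP[p1 p2] /=.
by rewrite !assemble_map // => x y xp yp; apply: rank_mono;
  [apply: mem_subseq xp | apply: mem_subseq yp | apply: mem_subseq xp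
  | apply: mem_subseq yp]; apply: subseq_flatten.
Qed.
End Vectors.

(** * The bialgebra axioms *)

Lemma couplings_nilr I (A : seq (seq I)) : couplings A [::] = [:: A].
Proof. by elim: A => //= x A ->. Qed.

Lemma assemble_surj_gt (a : permutation) (A : seq (seq nat)) :
  exists B, [/\ factorization B, {in flatten A & flatten B, forall x y, x < y}
               & a = assemble B].
Proof.
have [B [fB /allP AB ->]] := assemble_surj a (\max_(x <- flatten A) x).
exists B; split=> // x y xA /AB; apply: leq_ltn_trans.
exact: (@leq_bigmax_seq _ _ xpredT id).
Qed.

Section Bialgebra.
Local Open Scope ring_scope.
Variable K : fieldType.
Local Notation KS := {malg K[permutation]}.
Local Notation mul := (@coupling_product K).
Local Notation Delta := (@draw_coproduct K).
Local Notation nu := (@KS_counit K).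

Lemma coupling_product_linearl (y : KS) : linear (fun x : KS => mul x y).
Proof. exact: lin_ext_linear. Qed.

Lemma coupling_product_linearr (x : KS) : linear (mul x).
Proof. by apply: lin_ext_fun_linear => a; apply: lin_ext_linear. Qed.

Lemma KS_unit_linear : linear (@KS_unit K : K^o -> KS).
Proof.
by move=> c x y; apply/malgP => b;
  rewrite !(mcoeffD, mcoeffZ, mcoeffU) mulrnDl mulrnAr.
Qed.

Lemma KS_unitE (c : K) : KS_unit c = c *: (<< empty_permutation >> : KS).
Proof. by apply/malgP => b; rewrite mcoeffZ !mcoeffU mulrnAr mulr1. Qed.

Lemma sum_mull (I : Type) (r : seq I) (F : I -> KS) (y : KS) :
  mul (\sum_(i <- r) F i) y = \sum_(i <- r) mul (F i) y.
Proof. exact: (linear_sum_prop _ _ _ (coupling_product_linearl y)). Qed.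

Lemma sum_mulr (I : Type) (r : seq I) (F : I -> KS) (x : KS) :
  mul x (\sum_(i <- r) F i) = \sum_(i <- r) mul x (F i).
Proof. exact: (linear_sum_prop _ _ _ (coupling_product_linearr x)). Qed.

(** Linearity reduces the claim to three permutations. Represented on successively larger letters,
    they turn both bracketings into the sums of [sum_couplings_assoc]. *)
Lemma coupling_productA : associative mul.
Proof.
move=> x y z; move: x; apply: eq_linear => [||a].
- exact: coupling_product_linearl.
- exact: linear_comp (coupling_product_linearl z) (coupling_product_linearl y).
move: y; apply: eq_linear => [||b].
- exact: linear_comp (coupling_product_linearr _) (coupling_product_linearl z).
- exact: linear_comp (coupling_product_linearl z) (coupling_product_linearr _).
move: z; apply: eq_linear => [||c].
- exact: linear_comp (coupling_product_linearr _) (coupling_product_linearr _).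
- exact: coupling_product_linearr.
have [A [fA _ ->]] := assemble_surj a 0.
have [B [fB AB ->]] := assemble_surj_gt b A.
have [C [fC ABC ->]] := assemble_surj_gt c (A ++ B).
have AC : {in flatten A & flatten C, forall x y, (x < y)%N}.
  by move=> x y xA; apply: ABC; rewrite flatten_cat mem_cat xA.
have BC : {in flatten B & flatten C, forall x y, (x < y)%N}.
  by move=> x y xB; apply: ABC; rewrite flatten_cat mem_cat xB orbT.
rewrite !coupling_product_blocks // sum_mulr sum_mull.
transitivity (\sum_(E <- couplings B C) \sum_(G <- couplings A E)
                (<< assemble G >> : KS)).
  apply: eq_big_seq => E EBC; rewrite coupling_product_blocks //.
    exact: factorization_couplings fB fC BC EBC.
  move=> x y xA; rewrite (perm_mem (mem_couplings_perm EBC)) mem_cat.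
  by case/orP; [apply: AB | apply: AC].
rewrite -sum_couplings_assoc; apply: eq_big_seq => E EAB.
rewrite coupling_product_blocks //.
  exact: factorization_couplings fA fB AB EAB.
move=> x y; rewrite (perm_mem (mem_couplings_perm EAB)) -flatten_cat.
exact: ABC.
Qed.

Lemma coupling_product1l : left_id (KS_unit 1) mul.
Proof.
apply: eq_linear => [||a]; [exact: coupling_product_linearr | by move=> ? |].
have [A [fA _ ->]] := assemble_surj a 0; rewrite KS_unitE scale1r -assemble_nil.
by rewrite coupling_product_blocks // big_seq1.
Qed.

Lemma coupling_product1r : right_id (KS_unit 1) mul.
Proof.
apply: eq_linear => [||a]; [exact: coupling_product_linearl | by move=> ? |].
have [A [fA _ ->]] := assemble_surj a 0; rewrite KS_unitE scale1r -assemble_nil.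
by rewrite coupling_product_blocks // couplings_nilr big_seq1.
Qed.

Lemma KS_is_algebra : is_algebra mul (@KS_unit K).
Proof.
split.
- exact: coupling_product_linearl.
- exact: coupling_product_linearr.
- exact: KS_unit_linear.
- exact: coupling_productA.
- exact: coupling_product1l.
- exact: coupling_product1r.
Qed.

Lemma draw_coproduct_linear : linear Delta.
Proof. exact: lin_ext_linear. Qed.

Lemma KS_counit_linear : linear (nu : KS -> K^o).
Proof. exact: lin_ext_linear. Qed.

Lemma KS_counitU (a : permutation) : nu << a >> = (a == empty_permutation)%:R.
Proof. by rewrite /KS_counit lin_extU. Qed.

Lemma eq_linear_assemble (W : lmodType K) (h k : KS -> W) :
    linear h -> linear k ->
    (forall A, factorization A -> h << assemble A >> = k << assemble A >>) ->
  h =1 k.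
Proof.
move=> hL kL hk; apply: eq_linear => // a.
by have [A [fA _ ->]] := assemble_surj a 0; apply: hk.
Qed.

Lemma lin_ext_splits (W : lmodType K) (h : permutation * permutation -> W) A :
    factorization A ->
  lin_ext h (Delta << assemble A >>) =
  \sum_(p <- splits A) h (assemble p.1, assemble p.2).
Proof.
move=> fA; rewrite draw_coproduct_blocks // linear_sum_prop;
  last exact: lin_ext_linear.
by apply: eq_bigr => p _; rewrite lin_extU.
Qed.

(** Only the split that sends every block to the right contributes. *)
Lemma sum_splits_counitl T (V : nmodType) (A : seq T) (F : seq T -> V) :
  \sum_(p <- splits A) (if nilp p.1 then F p.2 else 0) = F A.
Proof.
elim: A F => [|x A IH] F; first by rewrite big_seq1.
rewrite (sum_splits_cons x A (fun l r => if nilp l then F r else 0)) /=.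
by rewrite (IH (fun r => F (x :: r))) big1 ?add0r.
Qed.

Lemma sum_splits_counitr T (V : nmodType) (A : seq T) (F : seq T -> V) :
  \sum_(p <- splits A) (if nilp p.2 then F p.1 else 0) = F A.
Proof.
by rewrite (sum_splits_swap A (fun r l => if nilp r then F l else 0))
  sum_splits_counitl.
Qed.

Lemma draw_coproduct_coassoc x :
  tensor_assoc (tensor_map Delta id (Delta x)) = tensor_map id Delta (Delta x).
Proof.
move: x; apply: eq_linear_assemble => [||A fA].
- apply: linear_comp (lin_ext_linear _) _.
  exact: linear_comp (lin_ext_linear _) draw_coproduct_linear.
- exact: linear_comp (lin_ext_linear _) draw_coproduct_linear.
rewrite /tensor_map !lin_ext_splits // /tensor_assoc.
rewrite linear_sum_prop; last exact: lin_ext_linear.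
transitivity (\sum_(p <- splits A) \sum_(q <- splits p.1)
    (<< (assemble q.1, (assemble q.2, assemble p.2)) >> : {malg K[_]})).
  apply: eq_big_seq => p /(factorization_splits fA)/andP[f1 f2] /=.
  rewrite draw_coproduct_blocks //.
  rewrite (linear_sum_prop _ _ _ (tensor_linearl _)) linear_sum_prop;
    last exact: lin_ext_linear.
  by apply: eq_bigr => q _; rewrite tensorU lin_extU.
rewrite (sum_splits_assoc A (fun u v w => << (assemble u, (assemble v, assemble w)) >>)).
apply: eq_big_seq => p /(factorization_splits fA)/andP[f1 f2] /=.
rewrite draw_coproduct_blocks // (linear_sum_prop _ _ _ (tensor_linearr _)).
by apply: eq_bigr => q _; rewrite tensorU.
Qed.

Lemma KS_is_coalgebra : is_coalgebra Delta nu.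
Proof.
split.
- exact: draw_coproduct_linear.
- by move=> c u v; rewrite KS_counit_linear.
- exact: draw_coproduct_coassoc.
- apply: eq_linear_assemble => [||A fA]; [|by move=> ?|].
    exact: linear_comp (lin_ext_linear _) draw_coproduct_linear.
  rewrite lin_ext_splits // -[RHS](sum_splits_counitl A (fun r => << assemble r >> : KS)).
  apply: eq_big_seq => p /(factorization_splits fA)/andP[f1 f2] /=.
  by rewrite KS_counitU assemble_eq_nil //; case: nilp;
    rewrite ?scale1r ?scale0r.
- apply: eq_linear_assemble => [||A fA]; [|by move=> ?|].
    exact: linear_comp (lin_ext_linear _) draw_coproduct_linear.
  rewrite lin_ext_splits // -[RHS](sum_splits_counitr A (fun r => << assemble r >> : KS)).
  apply: eq_big_seq => p /(factorization_splits fA)/andP[f1 f2] /=.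
  by rewrite KS_counitU assemble_eq_nil //; case: nilp;
    rewrite ?scale1r ?scale0r.
Qed.

Lemma draw_coproductM x y : Delta (mul x y) = tensor_mul mul (Delta x)
  (Delta y).
Proof.
move: x; apply: eq_linear => [||a].
- exact: linear_comp draw_coproduct_linear (coupling_product_linearl y).
- apply: (@linear_comp _ _ _ _ (fun t => tensor_mul mul t (Delta y)) Delta).
    exact: lin_ext_linear.
  exact: draw_coproduct_linear.
move: y; apply: eq_linear => [||b].
- exact: linear_comp draw_coproduct_linear (coupling_product_linearr _).
- apply: linear_comp draw_coproduct_linear.
  by apply: lin_ext_fun_linear => p; apply: lin_ext_linear.
have [A [fA _ ->]] := assemble_surj a 0.
have [B [fB AB ->]] := assemble_surj_gt b A.
rewrite coupling_product_blocks //
  (linear_sum_prop _ _ _ draw_coproduct_linear).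
transitivity (\sum_(C <- couplings A B) \sum_(p <- splits C)
    (<< (assemble p.1, assemble p.2) >> : {malg K[_]})).
  apply: eq_big_seq => C CAB; apply: draw_coproduct_blocks.
  exact: factorization_couplings CAB.
rewrite (sum_couplings_splits A B (fun u v => << (assemble u, assemble v) >>)).
rewrite /tensor_mul lin_ext_splits //; apply: eq_big_seq => p pA.
rewrite lin_ext_splits //; apply: eq_big_seq => q qB /=.
have /andP[fp1 fp2] := factorization_splits fA pA.
have /andP[fq1 fq2] := factorization_splits fB qB.
(* Sublists inherit the separation of letters, so the products of the parts are again sums over
   couplings. *)
have /andP[/subseq_flatten/mem_subseq sp1 /subseq_flatten/mem_subseq sp2] :=
  mem_splits_subseq pA.
have /andP[/subseq_flatten/mem_subseq sq1 /subseq_flatten/mem_subseq sq2] :=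
  mem_splits_subseq qB.
rewrite !coupling_product_blocks //; last 2 first.
- by move=> x y /sp2 xA /sq2; apply: AB.
- by move=> x y /sp1 xA /sq1; apply: AB.
rewrite (linear_sum_prop _ _ _ (tensor_linearl _)); apply: eq_bigr => C _.
rewrite (linear_sum_prop _ _ _ (tensor_linearr _)); apply: eq_bigr => D _.
by rewrite tensorU.
Qed.

(** All terms of a product of two permutations have the sum of the degrees as degree, so the empty
    permutation appears only when both factors are empty. *)
Lemma KS_counitM x y : nu (mul x y) = nu x * nu y.
Proof.
move: x; apply: (@eq_linear _ _ K^o) => [||a].
- exact: linear_comp KS_counit_linear (coupling_product_linearl y).
- by move=> c u v; rewrite KS_counit_linear mulrDl -mulrA.
move: y; apply: (@eq_linear _ _ K^o) => [||b].
- exact: linear_comp KS_counit_linear (coupling_product_linearr _).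
- by move=> c u v; rewrite KS_counit_linear mulrDr mulrCA.
have [A [fA _ ->]] := assemble_surj a 0.
have [B [fB AB ->]] := assemble_surj_gt b A.
rewrite coupling_product_blocks // (linear_sum_prop _ _ _ KS_counit_linear).
rewrite !KS_counitU -!degree_eq0 !degree_assemble //.
have [AB0|AB0] := boolP (size (flatten A ++ flatten B) == 0)%N.
  move: AB0; rewrite size_cat addn_eq0 => /andP[A0 B0]; rewrite A0 B0.
  move: A0 B0; rewrite -!degree_assemble // !degree_eq0 !assemble_eq_nil //.
  by move=> /nilP-> /nilP->;
    rewrite big_seq1 KS_counitU assemble_nil eqxx mulr1.
rewrite big1_seq => [|C /andP[_ CAB]].
  move: AB0; rewrite size_cat addn_eq0 negb_and.
  by case: eqP; case: eqP => //= *; rewrite ?mulr0 ?mul0r.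
have fC := factorization_couplings fA fB AB CAB.
rewrite KS_counitU -degree_eq0 degree_assemble //.
by rewrite (perm_size (mem_couplings_perm CAB)) (negbTE AB0).
Qed.

Lemma KS_is_bialgebra : is_bialgebra mul (@KS_unit K) Delta nu.
Proof.
split.
- exact: KS_is_algebra.
- exact: KS_is_coalgebra.
- exact: draw_coproductM.
- rewrite KS_unitE scale1r tensorU -assemble_nil draw_coproduct_blocks //.
  by rewrite big_seq1.
- exact: KS_counitM.
- by rewrite KS_unitE scale1r KS_counitU eqxx.
Qed.

Lemma draw_coproduct_cocommutative : is_cocommutative Delta.
Proof.
apply: eq_linear_assemble => [||A fA].
- exact: linear_comp (lin_ext_linear _) draw_coproduct_linear.
- exact: draw_coproduct_linear.
rewrite /tensor_swap lin_ext_splits // draw_coproduct_blocks //.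
exact: (sum_splits_swap A (fun l r => << (assemble l, assemble r) >>)).
Qed.
End Bialgebra.

(** * The antipode and the grading *)

Section Homogeneous.
Local Open Scope ring_scope.
Variables (K : fieldType) (B : choiceType) (d : B -> nat).
Local Notation V := {malg K[B]}.

Lemma homogeneous0 n : homogeneous d n (0 : V).
Proof. by move=> b; rewrite msupp0. Qed.

Lemma homogeneousU n b : d b = n -> homogeneous d n (<< b >> : V).
Proof. by move=> dn c; rewrite msuppU oner_eq0 in_fset1 => /eqP->. Qed.

Lemma homogeneousD n (u v : V) :
  homogeneous d n u -> homogeneous d n v -> homogeneous d n (u + v).
Proof.
move=> un vn b /(fsubsetP (msuppD_le _ _)); rewrite in_fsetU.
by case/orP; [apply: un | apply: vn].
Qed.

Lemma homogeneousZ n c (u : V) : homogeneous d n u -> homogeneous d n (c *: u).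
Proof. by move=> un b /(fsubsetP (msuppZ_le _ _)); apply: un. Qed.

Lemma homogeneous_sum n (I : eqType) (r : seq I) (F : I -> V) :
  (forall i, i \in r -> homogeneous d n (F i)) ->
  homogeneous d n (\sum_(i <- r) F i).
Proof.
by move=> Fn; rewrite big_seq; apply: big_ind => //;
  [apply: homogeneous0 | move=> *; apply: homogeneousD].
Qed.

Lemma homogeneous_lin_ext (C : choiceType) (e : C -> nat) m n
    (f : C -> V) (u : {malg K[C]}) :
    (forall c, e c = m -> homogeneous d n (f c)) ->
  homogeneous e m u -> homogeneous d n (lin_ext f u).
Proof. by move=> fn um b /msupp_lin_ext[c /um/fn]; apply. Qed.

End Homogeneous.

Section Antipode.
Local Open Scope ring_scope.
Variable K : fieldType.
Local Notation KS := {malg K[permutation]}.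
Local Notation mul := (@coupling_product K).
Local Notation Delta := (@draw_coproduct K).
Local Notation nu := (@KS_counit K).
Implicit Types (A B : seq (seq nat)) (f g h : seq (seq nat) -> KS).

Lemma coupling_product_graded m n x y :
  homogeneous degree m x -> homogeneous degree n y ->
  homogeneous degree (m + n)%N (mul x y).
Proof.
move=> xm yn; apply: (homogeneous_lin_ext _ xm) => a am.
apply: (homogeneous_lin_ext _ yn) => b bn.
have := coupling_productU K a b; rewrite /coupling_product !lin_extU => ->.
have [A [fA _ aE]] := assemble_surj a 0.
have [B [fB AB bE]] := assemble_surj_gt b A.
rewrite -coupling_productU aE bE coupling_product_blocks //.
apply: homogeneous_sum => C CAB; apply: homogeneousU.
rewrite degree_assemble; last exact: factorization_couplings CAB.
rewrite (perm_size (mem_couplings_perm CAB)) size_cat.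
by rewrite -!degree_assemble // -aE -bE am bn.
Qed.

Lemma draw_coproduct_graded n x :
  homogeneous degree n x -> homogeneous (tensor_deg degree) n (Delta x).
Proof.
apply: homogeneous_lin_ext => a an.
have := draw_coproductU K a; rewrite /draw_coproduct !lin_extU => ->.
apply: homogeneous_sum => p pa; apply: homogeneousU; rewrite /tensor_deg /=.
have /andP[f1 f2] := factorization_splits (factorization_atoms a) pa.
rewrite !degree_assemble // -size_cat -flatten_cat.
rewrite (perm_size (perm_flatten (mem_splits_perm pa))) flatten_atoms.
exact: an.
Qed.

(** Functions are convolved on arbitrary lists of blocks, with [splits] as coproduct; the identities
    below then need no condition on the letters. *)
Definition convolution f g A : KS :=
  \sum_(p <- splits A) mul (f p.1) (g p.2).

Definition convolution_unit A : KS := if nilp A then KS_unit 1 else 0.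

Lemma convolutionA f g h A :
  convolution (convolution f g) h A = convolution f (convolution g h) A.
Proof.
rewrite /convolution; under eq_bigr do rewrite sum_mull.
under [RHS]eq_bigr do rewrite sum_mulr.
under [RHS]eq_bigr do (under eq_bigr do rewrite coupling_productA).
exact: (sum_splits_assoc A (fun u v w => mul (mul (f u) (g v)) (h w))).
Qed.

Lemma mul0 (x : KS) : mul 0 x = 0.
Proof. exact: linear0_prop (coupling_product_linearl x). Qed.

Lemma mulx0 (x : KS) : mul x 0 = 0.
Proof. exact: linear0_prop (coupling_product_linearr x). Qed.

Lemma convolution1l f A : convolution convolution_unit f A = f A.
Proof.
rewrite -[RHS]sum_splits_counitl; apply: eq_bigr => p _;
  rewrite /convolution_unit.
by case: nilp; rewrite ?coupling_product1l ?mul0.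
Qed.

Lemma convolution1r f A : convolution f convolution_unit A = f A.
Proof.
rewrite -[RHS]sum_splits_counitr; apply: eq_bigr => p _;
  rewrite /convolution_unit.
by case: nilp; rewrite ?coupling_product1r ?mulx0.
Qed.

(* The convolution inverse of [fun A => << assemble A >>] is Takeuchi's series
of the powers of [reduced]; [reduced] vanishes on the empty list, so the terms
beyond the number of atoms are zero. *)
Definition reduced A : KS := convolution_unit A - << assemble A >>.

Fixpoint reduced_power k : seq (seq nat) -> KS :=
  if k is k'.+1 then convolution reduced (reduced_power k')
  else convolution_unit.

Definition antipode_blocks A : KS := \sum_(k < (size A).+1) reduced_power k A.

Definition antipode (x : KS) : KS := lin_ext
  (fun a : permutation => antipode_blocks (atoms a)) x.

(** A nonzero term would give at least one block to each of the [k] factors. *)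
Lemma reduced_power_vanish k A : (size A < k)%N -> reduced_power k A = 0.
Proof.
elim: k A => //= k IH A lt_k; rewrite /convolution big1_seq // => p /andP[_ pA].
have [p1|p1] := boolP (nilp p.1).
  rewrite (nilP p1) /reduced assemble_nil /convolution_unit /=.
  by rewrite KS_unitE scale1r subrr mul0.
rewrite IH ?mulx0 //; rewrite -ltnS; apply: leq_trans lt_k; rewrite ltnS.
rewrite -(perm_size (mem_splits_perm pA)) size_cat.
by case: (p.1) p1 => //= x s _; rewrite addSn ltnS leq_addl.
Qed.

(** Raising the truncation gives all parts of a split the same range of exponents, so that the sums
    can be exchanged. *)
Lemma antipode_blocksE n A : (size A < n)%N ->
  antipode_blocks A = \sum_(k < n) reduced_power k A.
Proof.
move=> An; rewrite -(big_mkord xpredT (fun k => reduced_power k A)).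
rewrite (big_cat_nat (leq0n _) An) /= big_mkord [X in _ + X]big1_seq ?addr0 //.
by move=> k; rewrite mem_index_iota => /andP[_ /andP[Ak _]];
  apply: reduced_power_vanish.
Qed.

Lemma reduced_powerSr k A :
  reduced_power k.+1 A = convolution (reduced_power k) reduced A.
Proof.
elim: k A => [|k IH] A; first by rewrite /= convolution1l convolution1r.
transitivity (convolution reduced (convolution (reduced_power k) reduced) A).
  by apply: eq_bigr => p _; rewrite -IH.
by rewrite -convolutionA.
Qed.

(** The assembling map is the convolution unit minus [reduced], so the sum telescopes: the power 0
    is left, and the power of exponent [(size A).+1] vanishes on [A]. *)
Lemma antipode_blocks_left A :
  \sum_(p <- splits A) mul (antipode_blocks p.1) << assemble p.2 >> =
  convolution_unit A.
Proof.
transitivity (antipode_blocks A - convolution antipode_blocks reduced A).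
  rewrite -{1}(convolution1r antipode_blocks) -sumrB; apply: eq_bigr => p _.
  rewrite -(linearB_prop _ _ (coupling_product_linearr _)); congr mul.
  by rewrite /reduced opprB addrC subrK.
have -> : convolution antipode_blocks reduced A =
    \sum_(k < (size A).+1) reduced_power k.+1 A.
  under eq_bigr do rewrite reduced_powerSr.
  rewrite exchange_big; apply: eq_big_seq => p pA.
  rewrite (@antipode_blocksE (size A).+1) ?sum_mull //.
  by rewrite -(perm_size (mem_splits_perm pA)) size_cat ltnS leq_addr.
rewrite /antipode_blocks big_ord_recl big_ord_recr /=.
rewrite -/(reduced_power (size A).+1 A) reduced_power_vanish // addr0 addrK.
by [].
Qed.

Lemma antipode_blocks_right A :
  \sum_(p <- splits A) mul << assemble p.1 >> (antipode_blocks p.2) =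
  convolution_unit A.
Proof.
transitivity (antipode_blocks A - convolution reduced antipode_blocks A).
  rewrite -{1}(convolution1l antipode_blocks) -sumrB; apply: eq_bigr => p _.
  rewrite -(linearB_prop _ _ (coupling_product_linearl _)); congr mul.
  by rewrite /reduced opprB addrC subrK.
have -> : convolution reduced antipode_blocks A =
    \sum_(k < (size A).+1) reduced_power k.+1 A.
  rewrite exchange_big; apply: eq_big_seq => p pA.
  rewrite (@antipode_blocksE (size A).+1) ?sum_mulr //.
  by rewrite -(perm_size (mem_splits_perm pA)) size_cat ltnS leq_addl.
rewrite /antipode_blocks big_ord_recl big_ord_recr /=.
rewrite -/(reduced_power (size A).+1 A) reduced_power_vanish // addr0 addrK.
by [].
Qed.

(** The antipode is defined through the atoms of a permutation; this invariance allows it to be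
    computed on any factorization. *)
Lemma reduced_power_map k (f : nat -> nat) A :
    {in flatten A &, {mono f : x y / (x <= y)%N}} ->
  reduced_power k (map (map f) A) = reduced_power k A.
Proof.
elim: k A => [|k IH] A fA; first by case: A fA.
rewrite /= /convolution splits_map big_map; apply: eq_big_seq => p.
case/mem_splits_subseq/andP=> /subseq_flatten/mem_subseq p1
  /subseq_flatten/mem_subseq p2 /=.
rewrite IH => [|x y /p2 xp /p2]; last exact: fA.
congr mul; rewrite /reduced assemble_map => [|x y /p1 xp /p1]; last exact: fA.
by case: (p.1).
Qed.

Lemma antipodeU A : factorization A -> antipode << assemble A >> =
  antipode_blocks A.
Proof.
move=> fA; rewrite /antipode lin_extU atoms_standard //.
rewrite /antipode_blocks size_map; apply: eq_bigr => k _.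
exact/reduced_power_map/rank_mono.
Qed.

Lemma convolution_unit_counit A : factorization A ->
  convolution_unit A = KS_unit (nu << assemble A >>).
Proof.
move=> fA; rewrite KS_counitU assemble_eq_nil // /convolution_unit.
by case: nilp; rewrite // KS_unitE scale0r.
Qed.

Lemma antipodeP : is_antipode mul (@KS_unit K) Delta nu antipode.
Proof.
split; first exact: lin_ext_linear.
- apply: eq_linear_assemble => [||A fA].
  + by move=> c u v; rewrite draw_coproduct_linear lin_ext_linear.
  + by move=> c u v; rewrite KS_counit_linear KS_unit_linear.
  rewrite lin_ext_splits // -convolution_unit_counit // -antipode_blocks_left.
  apply: eq_big_seq => p /(factorization_splits fA)/andP[f1 f2] /=.
  by rewrite antipodeU.
- apply: eq_linear_assemble => [||A fA].
  + by move=> c u v; rewrite draw_coproduct_linear lin_ext_linear.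
  + by move=> c u v; rewrite KS_counit_linear KS_unit_linear.
  rewrite lin_ext_splits // -convolution_unit_counit // -antipode_blocks_right.
  apply: eq_big_seq => p /(factorization_splits fA)/andP[f1 f2] /=.
  by rewrite antipodeU.
Qed.

(** * Degrees of the unit and the antipode, and connectedness *)

Lemma KS_unit_graded c : homogeneous degree 0 (KS_unit c : KS).
Proof. by rewrite KS_unitE; apply/homogeneousZ/homogeneousU. Qed.

Lemma convolution_unit_graded A :
  homogeneous degree (size (flatten A)) (convolution_unit A).
Proof.
rewrite /convolution_unit; case: nilP => [->|_]; first exact: KS_unit_graded.
exact: homogeneous0.
Qed.

Lemma reduced_power_graded k A : factorization A ->
  homogeneous degree (size (flatten A)) (reduced_power k A).
Proof.
elim: k A => [|k IH] A fA; first exact: convolution_unit_graded.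
apply: homogeneous_sum => p pA.
have /andP[f1 f2] := factorization_splits fA pA.
rewrite -(perm_size (perm_flatten (mem_splits_perm pA))) flatten_cat size_cat.
apply: coupling_product_graded; last exact: IH.
apply: homogeneousD; first exact: convolution_unit_graded.
rewrite -scaleN1r; apply/homogeneousZ/homogeneousU.
exact: degree_assemble.
Qed.

Lemma antipode_graded n x : homogeneous degree n x -> homogeneous degree n
  (antipode x).
Proof.
apply: homogeneous_lin_ext => a <-; apply: homogeneous_sum => k _.
by have := reduced_power_graded (k := k) (factorization_atoms a);
  rewrite flatten_atoms.
Qed.

Lemma KS_is_graded_hopf_algebra :
  is_graded_hopf_algebra degree mul (@KS_unit K) Delta nu.
Proof.
split.
- exact: KS_is_bialgebra.
- by exists antipode; split; [apply: antipodeP | apply: antipode_graded].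
- exact: coupling_product_graded.
- exact: KS_unit_graded.
- exact: draw_coproduct_graded.
- move=> n x xn n0;
  rewrite /KS_counit /lin_ext big1_seq // => a /andP[_ /xn an].
  by rewrite -degree_eq0 an (introF eqP n0) scaler0.
Qed.

Lemma KS_is_connected : is_connected K degree.
Proof.
exists (@KS_unit K); split.
- exact: KS_unit_linear.
- by move=> c c' /(congr1 (mcoeff empty_permutation)); rewrite !mcoeffUU.
- move=> v; split=> [v0|[c ->]]; last exact: KS_unit_graded.
  exists v@_empty_permutation; apply/malgP => a; rewrite mcoeffU.
  case: eqP => [<- //|a0]; rewrite mcoeff_outdom //.
  by apply/negP => /v0/eqP; rewrite degree_eq0 => /eqP aE; apply: a0.
Qed.
End Antipode.

(** * Freeness *)

Lemma direct_sum_subproof (a b : permutation) :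
  perm_eq (a ++ shift (degree a) b) (iota 1 (size (a ++ shift (degree a) b))).
Proof.
rewrite size_cat size_map iotaD; apply: perm_cat; first by case: a.
rewrite addnC iotaDl /shift (eq_map (fun x => addnC x (degree a))).
by apply: perm_map; case: b.
Qed.

Definition direct_sum (a b : permutation) : permutation :=
  Permutation (direct_sum_subproof a b).

(** The lengths tested run from 1 to [size a] minus 1, that is, over the proper nonempty prefixes.
    These are the permutations also called connected. *)
Definition indecomposable (a : permutation) : bool :=
  (a != empty_permutation) &&
  all (fun i => ~~ perm_eq (take i a) (iota 1 i)) (iota 1 (size a).-1).

Definition indecomposables := {a : permutation | indecomposable a}.

Definition sum_indecomposables (s : seq indecomposables) : permutation :=
  foldr (fun x b => direct_sum (val x) b) empty_permutation s.

(** Were [a] shorter than [b], it would be a proper prefix of [b] and a permutation by itself. *)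
Lemma indecomposable_prefix (a b c d : permutation) :
    indecomposable a -> indecomposable b -> direct_sum a c = direct_sum b d ->
  size b <= size a.
Proof.
case/andP=> a0 _ /andP[_ /allP b_indec] /(congr1 val) /= abE.
rewrite leqNgt; apply/negP => lt_ab.
have a1 : 0 < size a by rewrite lt0n -/(degree a) degree_eq0.
have /negP[] : ~~ perm_eq (take (size a) b) (iota 1 (size a)).
  by apply: b_indec; rewrite mem_iota a1 add1n prednK // (leq_trans _ lt_ab).
have -> : take (size a) b = a.
  have := congr1 (take (size a)) abE.
  by rewrite take_size_cat // takel_cat ?(ltnW lt_ab).
by case: (a).
Qed.

Lemma sum_indecomposables_inj : injective sum_indecomposables.
Proof.
have nil_cons x s : empty_permutation = sum_indecomposables (x :: s) -> False.
  case: x => x /= x_indec /(congr1 (fun a : permutation => size a)) /=.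
  rewrite size_cat => /esym/eqP; rewrite addn_eq0 => /andP[x0 _].
  by case/andP: x_indec; rewrite -degree_eq0 [degree x == 0]x0.
elim=> [|x s IH] [|y t] // E;
  [by case: (nil_cons _ _ E)| by case: (nil_cons _ _ (esym E))|].
have xy : size (val x) = size (val y).
  apply/eqP; rewrite eqn_leq (indecomposable_prefix (valP y) (valP x) (esym E)).
  by rewrite (indecomposable_prefix (valP x) (valP y) E).
move/(congr1 val): E => /= /eqP;
  rewrite eqseq_cat // => /andP[/eqP xyE /eqP stE].
have -> : x = y by do 2!apply: val_inj.
congr cons; apply/IH/val_inj; move: stE; rewrite /degree xy.
by apply: inj_map => u v /addIn.
Qed.

(** The letters after such a prefix are those from [i] plus 1 to [size a]; lowered by [i], they form
    a permutation. *)
Lemma direct_sum_decomposition (a : permutation) i : i <= size a ->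
    perm_eq (take i a) (iota 1 i) ->
  exists b c : permutation, [/\ val b = take i a, degree b = i & a = direct_sum b c].
Proof.
move=> le_i Hi; have bP : perm_eq (take i a) (iota 1 (size (take i a))).
  by rewrite size_takel.
pose w := [seq x - i | x <- drop i a].
have dropP : perm_eq (drop i a) (map (addn i) (iota 1 (size a - i))).
  rewrite -iotaDl addn1 -(perm_cat2l (take i a)) cat_take_drop.
  rewrite perm_sym (permPl (perm_cat Hi (perm_refl _))) -iotaD subnKC //
    perm_sym.
  by case: (a).
have wP : perm_eq w (iota 1 (size w)).
  rewrite size_map size_drop (perm_trans (perm_map _ dropP)) // -map_comp.
  by rewrite (eq_map (addKn i)) map_id.
have degb : degree (Permutation bP) = i by rewrite /degree /= size_takel.
exists (Permutation bP), (Permutation wP); split=> //.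
apply: val_inj; rewrite /= degb -[LHS](cat_take_drop i); congr (_ ++ _).
rewrite /shift -map_comp -[LHS]map_id; apply/eq_in_map => x /=.
by rewrite (perm_mem dropP) => /mapP[y _ ->]; rewrite addKn addnC.
Qed.

(** The shortest nonempty prefix that is itself a permutation is indecomposable, and the rest is
    shorter. The equality is boolean so that a decomposition can be chosen. *)
Lemma sum_indecomposables_surj a : exists s, sum_indecomposables s == a.
Proof.
elim: {a}(size a) {-2}a (leqnn (size a)) => [|n IH] a le_a.
  by exists [::]; rewrite eq_sym -degree_eq0 -leqn0.
have [a0|a0] := eqVneq a empty_permutation; first by exists [::]; rewrite a0.
have a1 : 0 < size a by rewrite lt0n -/(degree a) degree_eq0.
have ex_i : exists i, [&& 0 < i, i <= size a & perm_eq (take i a) (iota 1 i)].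
  by exists (size a); rewrite a1 leqnn take_size; case: (a).
case: (ex_minnP ex_i) => i /and3P[i0 le_i Hi] min_i.
have [b [c [bE bi aE]]] := direct_sum_decomposition le_i Hi.
have b_indec : indecomposable b.
  rewrite /indecomposable -degree_eq0 bi -lt0n i0 /=; apply/allP => j.
  rewrite mem_iota add1n -/(degree b) bi prednK // => /andP[j0 ji].
  rewrite -[word b]/(val b) bE take_takel ?(ltnW ji) //; apply/negP => Hj.
  by have := min_i j;
    rewrite j0 Hj (leq_trans (ltnW ji)) // leqNgt ji => /(_ isT).
have [|s /eqP sE] := IH c.
  rewrite -ltnS; apply: leq_trans le_a; rewrite -/(degree a) aE /degree /=.
  by rewrite size_cat size_map -[size b]/(degree b) bi -add1n leq_add2r.
by exists (Sub b b_indec :: s); rewrite aE /= sE.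
Qed.

(** * The algebra map from the free algebra on the indecomposables *)

Section Free.
Local Open Scope ring_scope.
Variable K : fieldType.
Local Notation KS := {malg K[permutation]}.
Local Notation mul := (@coupling_product K).
Local Notation rk := (fun a : permutation => num_atoms a).

(** The empty matching contributes the direct sum, without merging atoms; every other matching
    merges at least two. *)
Lemma coupling_product_lead (a b : permutation) :
  [/\ num_atoms (direct_sum a b) = (num_atoms a + num_atoms b)%N
    & exists2 s : seq permutation,
        mul << a >> << b >> = << direct_sum a b >> + \sum_(c <- s) << c >>
      & {in s, forall c, num_atoms (word c) < num_atoms a + num_atoms b}%N].
Proof.
set B := map (shift (degree a)) (atoms b).
have fB : factorization B.
  apply: factorization_map (factorization_atoms b) => x y _ _.
  by rewrite leq_add2r.
have AB : {in flatten (atoms a) & flatten B, forall x y, (x < y)%N}.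
  move=> x y;
    rewrite flatten_atoms /B -map_flatten flatten_atoms mem_permutation.
  move=> /andP[_ xa] /mapP[z + ->]; rewrite mem_permutation => /andP[z0 _].
  by rewrite -add1n leq_add.
have atoms_size C : C \in couplings (atoms a) B -> num_atoms (assemble C) =
  size C.
  move=> CAB; rewrite atoms_standard ?size_map //.
  exact: factorization_couplings (factorization_atoms a) fB AB CAB.
have [s sE sP] := couplings_lead (atoms a) B.
have lead : assemble (atoms a ++ B) = direct_sum a b.
  rewrite /assemble flatten_cat /B -map_flatten !flatten_atoms.
  exact: (standardK (direct_sum a b)).
split; first by rewrite -lead atoms_size ?size_cat ?size_map // sE mem_head.
exists (map assemble s);
  first by rewrite coupling_productU sE big_cons big_map lead.
move=> _ /mapP[C Cs ->]; rewrite atoms_size; last by rewrite sE inE Cs orbT.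
by have := sP C Cs; rewrite size_map.
Qed.

Definition free_monomial (s : seq indecomposables) : KS :=
  foldr (fun x v => mul << val x >> v) << empty_permutation >> s.

Lemma msupp_sumU (T : choiceType) (s : seq T) c :
  c \in msupp (\sum_(b <- s) << b >> : {malg K[T]}) -> c \in s.
Proof.
move=> cs; apply/negPn/negP => c_s; move: cs;
  rewrite -mcoeff_neq0 raddf_sum big1_seq ?eqxx //.
by move=> b /andP[_ bs]; rewrite /= mcoeffU; case: eqP => // bc;
  rewrite -bc bs in c_s.
Qed.

Lemma free_monomial_lead s c :
  c \in msupp (free_monomial s - << sum_indecomposables s >>) ->
  (num_atoms c < num_atoms (sum_indecomposables s))%N.
Proof.
elim: s c => [|x s IH] c; first by rewrite /= subrr msupp0.
have [rkE [r rE rP]] := coupling_product_lead (val x) (sum_indecomposables s).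
(* The error is the product of [val x] with the error for [s], plus the lower terms in the product
   of [val x] with the direct sum of [s]. *)
rewrite /= -[mul _ _](subrK (mul << val x >> << sum_indecomposables s >>))
  -addrA.
rewrite -(linearB_prop _ _ (coupling_product_linearr _)) rkE.
move=> /(fsubsetP (msuppD_le _ _)); rewrite in_fsetU => /orP[|]; last first.
  by rewrite rE addrC addrA addNr add0r => /msupp_sumU/rP.
rewrite (lin_ext_eq _ (coupling_product_linearr _))
  => /msupp_lin_ext[b /IH lt_b].
have [_ [r' -> r'P]] := coupling_product_lead (val x) b.
have [bE _] := coupling_product_lead (val x) b.
move=> /(fsubsetP (msuppD_le _ _)); rewrite in_fsetU => /orP[|].
  by rewrite msuppU oner_eq0 in_fset1 => /eqP->; rewrite bE ltn_add2l.
by move=> /msupp_sumU/r'P lt_c; apply: ltn_trans lt_c _; rewrite ltn_add2l.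
Qed.

Lemma KS_is_free : is_free_algebra mul (@KS_unit K).
Proof.
pose X : choiceType := indecomposables.
pose phi := lin_ext (fun w : {fmonom X} => free_monomial (w : seq X)).
have phi_linear : linear phi by apply: lin_ext_linear.
exists X, phi; split=> //.
(* Words in the indecomposables correspond bijectively to permutations, and a monomial differs from
   its direct sum by terms with fewer atoms. *)
- apply: (@triangular_bij _ _ _ (fun w : {fmonom X} => sum_indecomposables w)
            (fun a : permutation => num_atoms a)).
  + exact: phi_linear.
  + exists (fun a => FMonom (xchoose (sum_indecomposables_surj a))) => [w|a].
      apply/val_inj/sum_indecomposables_inj.
      exact/eqP/(xchooseP (sum_indecomposables_surj _)).
    exact/eqP/(xchooseP (sum_indecomposables_surj a)).
  + by move=> w b; rewrite /phi lin_extU; apply: free_monomial_lead.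
- by rewrite /phi lin_extU fm1 KS_unitE scale1r.
- have mulU (w : {fmonom X}) (v : {malg K[{fmonom X}]}) :
      << w >> * v = lin_ext (fun w' => << mmul w w' >>) v.
    rewrite malgM_def fgmulUg; apply: eq_bigr => w' _.
    by apply/malgP => k; rewrite mcoeffZ !mcoeffU mul1r mulrnAr mulr1.
  move=> x y; move: x; apply: eq_linear => [||w].
  + by move=> c u v; rewrite mulrDl -scalerAl phi_linear.
  + by move=> c u v; rewrite phi_linear coupling_product_linearl.
  move: y; apply: eq_linear => [||w'].
  + by move=> c u v; rewrite !mulU lin_ext_linear phi_linear.
  + by move=> c u v; rewrite phi_linear coupling_product_linearr.
  rewrite mulU /phi !lin_extU fmM /free_monomial foldr_cat.
  elim: (w : seq X) => [|x s IH] /=; last by rewrite IH coupling_productA.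
  by rewrite -[LHS]coupling_product1l KS_unitE scale1r.
Qed.
End Free.

Theorem mainTheorem1 (K : fieldType) :
  [/\ is_graded_hopf_algebra degree
        (@coupling_product K) (@KS_unit K) (@draw_coproduct K) (@KS_counit K),
      is_connected K degree,
      is_cocommutative (@draw_coproduct K)
    & is_free_algebra (@coupling_product K) (@KS_unit K)].
Proof.
split.
- exact: KS_is_graded_hopf_algebra.
- exact: KS_is_connected.
- exact: draw_coproduct_cocommutative.
- exact: KS_is_free.
Qed.
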